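(* Let $\psi(t)$ be a wavelet with $N$ vanishing moments. Then its Hilbert transform $\mathcal{H}\{\psi\}(t)$ has at least $N$ vanishing moments.
   Context: A function $\psi(t)$ is a (mother) wavelet if and only if (i) $\psi$ is in the space $L^2(\mathbb{R})$ of finite energy functions and (ii) $\psi$ satisfies the admissibility condition $\int_{-\infty}^{\infty}\frac{|\Psi(\omega)|^2}{|\omega|}\,d\omega<+\infty$, where $\Psi(\omega)$ is the Fourier transform of $\psi(t)$, with $\omega$ the angular frequency. The Hilbert transform of a function $g$ is $\mathcal{H}\{g\}(t)=\mathrm{p.v.}\,\frac{1}{\pi}\int_{-\infty}^{\infty}\frac{g(\tau)}{t-\tau}\,d\tau$, where p.v. denotes the Cauchy principal value. The $n$th moment of a function $f$ is $M_n[f(t)]=\int_{-\infty}^{\infty}t^n f(t)\,dt$, and $f$ has $N$ vanishing moments if $M_n[f(t)]=0$ for $n=0,1,\ldots,N-1$.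
   Formalization: Moments are absolutely convergent integrals; for N>0 it is additionally assumed that the moment of order N-1 of H{psi} exists, since otherwise the claim fails, e.g. N=1, psi = 1_{t>3}/(t log^2 t) - c 1_{[0,1]} with integral zero. *)

(* Defs.v *)
From mathcomp Require Export all_boot all_order all_algebra.
From mathcomp Require Export all_classical all_reals all_analysis.
From mathcomp Require Export complex.

Set Implicit Arguments.
Unset Strict Implicit.
Unset Printing Implicit Defensive.

Import Order.TTheory GRing.Theory Num.Theory.
Import numFieldNormedType.Exports.

Local Open Scope classical_set_scope.
Local Open Scope ring_scope.
Local Open Scope complex_scope.

(* Signals are complex valued, f : R -> R[i]; a real signal is one with zero
   imaginary part. Complex integrability and integration are componentwise. *)
Section Signals.
Context {R : realType}.
Implicit Types (f g psi Psi : R -> R[i]) (D : set R) (t w A : R) (n N : nat).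

Local Notation mu := (@lebesgue_measure R).

Definition Cintegrable D f : Prop :=
  mu.-integrable D (fun t => (complex.Re (f t))%:E) /\
  mu.-integrable D (fun t => (complex.Im (f t))%:E).

Definition Cintegral D f : R[i] :=
  (\int[mu]_(t in D) complex.Re (f t)) +i* (\int[mu]_(t in D) complex.Im (f t)).

Definition finite_energy f : Prop :=
  (fun t => complex.Re (f t)) \in Lfun mu 2%:E /\
  (fun t => complex.Im (f t)) \in Lfun mu 2%:E.

Definition energy f : \bar R :=
  (\int[mu]_t ((Normc.normc (f t)) ^+ 2)%:E)%E.

(* The integral of f(t) exp(-i w t) over [-A, A]. *)
Definition truncated_fourier A f w : R[i] :=
  Cintegral `[- A, A] (fun t => f t * (cos (w * t) -i* sin (w * t))).

(* A finite-energy f need not be integrable, so its Fourier transform is the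
   L^2 limit of the transforms of its truncations (Plancherel); Psi is
   determined by psi only up to a null set. *)
Definition is_fourier psi Psi : Prop :=
  finite_energy Psi /\
  energy (fun w => Psi w - truncated_fourier A psi w) @[A --> +oo%R] --> 0%E.

(* The value of the integrand at w = 0 is irrelevant. *)
Definition admissible psi : Prop :=
  exists2 Psi, is_fourier psi Psi &
    (\int[mu]_w ((Normc.normc (Psi w)) ^+ 2 / `|w|)%:E < +oo)%E.

Definition wavelet psi : Prop := finite_energy psi /\ admissible psi.

(* For g in L^2 the truncated integral converges absolutely at infinity, so only
   the singularity tau = t has to be excised. The limit exists for almost every
   t; elsewhere lim returns an arbitrary value. *)
Definition hilbertR (g : R -> R) t : R :=
  lim ((pi^-1 * \int[mu]_(tau in [set tau | e < `|t - tau|]) (g tau / (t - tau)))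
         @[e --> 0^'+]).

Definition hilbert g t : R[i] :=
  hilbertR (fun tau => complex.Re (g tau)) t
  +i* hilbertR (fun tau => complex.Im (g tau)) t.

Definition has_moment n f : Prop :=
  Cintegrable setT (fun t => (t ^+ n)%:C * f t).

Definition moment n f : R[i] := Cintegral setT (fun t => (t ^+ n)%:C * f t).

(* [moment] is a total function (the integral of a non-integrable function is
   a default value), hence the explicit existence requirement. *)
Definition vanishing_moments N f : Prop :=
  forall n, (n < N)%N -> has_moment n f /\ moment n f = 0.

End Signals.

(* Main.v *)
Require Import Defs.
From mathcomp Require Import ring lra measurable_realfun.

Set Implicit Arguments.
Unset Strict Implicit.
Unset Printing Implicit Defensive.

Import Order.TTheory GRing.Theory Num.Theory.
Import numFieldNormedType.Exports.

Local Open Scope classical_set_scope.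
Local Open Scope ring_scope.

(** Splitting a complex signal into its two components, it is enough to treat
    a real [g] in L1 and L2.  Its Hilbert transform is the boundary value of a
    conjugate harmonic function, and its moments are read off the behaviour
    of that function high above the origin.

    Write p_a(u) = a / (u^2 + a^2) and q_a(u) = u / (u^2 + a^2): these are pi
    times the Poisson kernel and its harmonic conjugate.  Partial fractions
    give q_a * q_b = - pi p_(a+b) and p_a * q_b = pi q_(a+b)
    ([Rint_qker_qker], [Rint_pker_qker]).  Hence
    <q_a * g, q_b * g> = pi phi(a + b) with phi(c) = <p_c * g, g>, and the
    squared distance of q_a * g and q_b * g is
    pi (phi(2a) + phi(2b) - 2 phi(a+b)).  So phi is midpoint convex; being
    bounded above by pi |g|^2 on the half-line it is nonincreasing, therefore
    it has a limit at 0 and q_a * g is a Cauchy family in L2 as a tends to 0.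
    By the semigroup identities the limit h satisfies p_y * h = pi q_y * g and
    q_y * h = - pi p_y * g for all y > 0 ([hilbert_L2_limit]).

    At a common Lebesgue point of g and h, p_e * h tends to pi h, hence
    q_e * g tends to h; and the kernel truncated at distance e differs from
    q_e by an odd kernel bounded by p_e, so that the truncated integrals have
    the same limit.  Therefore the principal value exists almost everywhere
    and the Hilbert transform H of g is h / pi ([hilbertR_ae_eq]).

    The two identities for h, taken at the point 0, are the real and imaginary
    parts of: the integral of (H + i g)(t) / (t - i y) vanishes for y > 0.
    Expanding 1 / (t - i y) in powers of t / (i y) and letting y tend to
    infinity annihilates the moments of H + i g one after the other
    ([conjugate_moments]), as long as they exist.  Those of order below N do:
    H is square integrable near 0, and t^(N-1) H(t) is integrable by
    hypothesis ([monomial_mul_L1]). *)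

(** * Integrable and square integrable functions on the line *)

Section Integrals.
Context {R : realType}.
Local Notation mu := (@lebesgue_measure R).
Implicit Types f g : R -> R.

(** A plain predicate on functions, so that the side conditions of the integral
    lemmas below need not mention the measure or the extended reals. *)
Definition L1 f : Prop := mu.-integrable setT (EFin \o f).

(** Squares rather than norms: every estimate below uses the integral of the
    square itself, through the inequality 2 |x y| <= l x^2 + y^2 / l. *)
Definition L2 f : Prop := measurable_fun setT f /\ L1 (fun x => f x ^+ 2).

Lemma ae_imply (P Q : R -> Prop) : (forall x, P x -> Q x) ->
  {ae mu, forall x, P x} -> {ae mu, forall x, Q x}.
Proof.
move=> PQ; apply: negligibleS => x /= nQ nP; exact/nQ/PQ.
Qed.

Lemma ae_and (P Q : R -> Prop) : {ae mu, forall x, P x} ->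
  {ae mu, forall x, Q x} -> {ae mu, forall x, P x /\ Q x}.
Proof.
move=> hP hQ; apply: (negligibleS _ (negligibleU hP hQ)) => x /= nPQ.
by case: (pselect (P x)) => [Px|nP]; [right=> Qx; apply: nPQ|left].
Qed.

Lemma L1_measurable f : L1 f -> measurable_fun setT f.
Proof. by move=> /measurable_int /measurable_EFinP. Qed.

Lemma measurable_fun_patch f (D : set R) : measurable D ->
  measurable_fun setT f -> measurable_fun setT (f \_ D).
Proof.
move=> mD mf; apply: (measurable_restrictT f mD).1.
exact: (measurable_funS measurableT _ mf).
Qed.

Lemma L1_le f g : measurable_fun setT f -> L1 g ->
  (forall x, `|f x| <= g x) -> L1 f.
Proof.
move=> mf ig fg; apply: le_integrable ig => //; first exact/measurable_EFinP.
by move=> x _ /=; rewrite lee_fin (le_trans (fg x))// ler_norm.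
Qed.

Lemma L1D f g : L1 f -> L1 g -> L1 (fun x => f x + g x).
Proof. by move=> i1 i2; exact: (integrableD measurableT i1 i2). Qed.

Lemma L1B f g : L1 f -> L1 g -> L1 (fun x => f x - g x).
Proof. by move=> i1 i2; exact: (integrableB measurableT i1 i2). Qed.

Lemma L1Z (k : R) f : L1 f -> L1 (fun x => k * f x).
Proof. by move=> i1; exact: (integrableZl measurableT k i1). Qed.

Lemma L1_norm f : L1 f -> L1 (fun x => `|f x|).
Proof. exact: integrable_norm. Qed.

Lemma L2_measurable f : L2 f -> measurable_fun setT f.
Proof. by case. Qed.

Lemma L2_mul f g : L2 f -> L2 g -> L1 (fun x => f x * g x).
Proof.
move=> [mf f2] [mg g2]; apply: (L1_le _ (L1Z 2^-1 (L1D f2 g2))).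
  exact: measurable_funM.
move=> x; have := sqr_ge0 (f x + g x); have := sqr_ge0 (f x - g x).
by rewrite !expr2 ler_norml => *; apply/andP; split; lra.
Qed.

Lemma L2Z k f : L2 f -> L2 (fun x => k * f x).
Proof.
move=> [mf f2]; split; first exact: measurable_funM.
by apply: eq_integrable (L1Z (k ^+ 2) f2) => // x _ /=; rewrite exprMn.
Qed.

Lemma L2_le f g : measurable_fun setT f -> L2 g ->
  (forall x, `|f x| <= `|g x|) -> L2 f.
Proof.
move=> mf [mg g2] fg; split => //; apply: (L1_le _ g2).
  exact: measurable_funX.
move=> x; rewrite ger0_norm ?sqr_ge0//.
by rewrite -(real_normK (num_real (f x))) -(real_normK (num_real (g x))) lerXn2r ?nnegrE.
Qed.

Lemma L2B f g : L2 f -> L2 g -> L2 (fun x => f x - g x).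
Proof.
move=> [mf f2] [mg g2]; split; first exact: measurable_funB.
apply: (L1_le _ (L1Z 2 (L1D f2 g2))).
  by apply: measurable_funX; exact: measurable_funB.
move=> x; rewrite ger0_norm ?sqr_ge0//.
by have := sqr_ge0 (f x + g x); rewrite !expr2 => *; lra.
Qed.

Lemma RintD f g : L1 f -> L1 g ->
  \int[mu]_x (f x + g x) = \int[mu]_x f x + \int[mu]_x g x.
Proof. by move=> *; exact: RintegralD. Qed.

Lemma RintB f g : L1 f -> L1 g ->
  \int[mu]_x (f x - g x) = \int[mu]_x f x - \int[mu]_x g x.
Proof. by move=> *; exact: RintegralB. Qed.

Lemma RintZ k f : L1 f -> \int[mu]_x (k * f x) = k * \int[mu]_x f x.
Proof. by move=> *; exact: RintegralZl. Qed.

Lemma Rint_le f g : L1 f -> L1 g -> (forall x, f x <= g x) ->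
  \int[mu]_x f x <= \int[mu]_x g x.
Proof. by move=> i1 i2 fg; apply: le_Rintegral. Qed.

Lemma Rint_norm f : L1 f -> `|\int[mu]_x f x| <= \int[mu]_x `|f x|.
Proof. by move=> i1; exact: le_normr_Rintegral. Qed.

Lemma Rint_ge0 f : (forall x, 0 <= f x) -> 0 <= \int[mu]_x f x.
Proof. by move=> h; apply: Rintegral_ge0. Qed.

Lemma eq_Rint f g : f =1 g -> \int[mu]_x f x = \int[mu]_x g x.
Proof. by move=> fg; apply: eq_Rintegral => x _; exact: fg. Qed.

Lemma EFin_Rint f : L1 f -> (\int[mu]_x f x)%:E = (\int[mu]_x (f x)%:E)%E.
Proof. by move=> i1; rewrite /Rintegral fineK//; exact: integrable_fin_num. Qed.

(** Equality off a null set suffices: the convolution identities of the kernels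
    are only established off the diagonal. *)
Lemma eq_Rint_ae f g : measurable_fun setT f -> measurable_fun setT g ->
  {ae mu, forall x, f x = g x} -> \int[mu]_x f x = \int[mu]_x g x.
Proof.
move=> mf mg fg; rewrite /Rintegral; congr fine; apply: ae_eq_integral => //.
- exact/measurable_EFinP.
- exact/measurable_EFinP.
by apply: ae_imply fg => x /= ->.
Qed.

Lemma L1_ae f g : measurable_fun setT f -> L1 g ->
  {ae mu, forall x, f x = g x} -> L1 f.
Proof.
move=> mf ig fg; apply/integrableP; split; first exact/measurable_EFinP.
case/integrableP: ig => mg; congr (_ < _)%E; apply: ae_eq_integral => //.
- by apply: measurableT_comp.
- by apply: measurableT_comp => //; exact/measurable_EFinP.
by apply: ae_imply fg => x /= ->.
Qed.

Lemma ae_neq (s : R) : {ae mu, forall x, x <> s}.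
Proof.
exists [set s]; split => //; first exact: lebesgue_measure_set1.
move=> x /= nxs; apply: contrapT => xs; apply: nxs => ?; exact: xs.
Qed.

Lemma L1_bounded_ge0 f (M : R) : measurable_fun setT f -> (forall x, 0 <= f x) ->
  ((\int[mu]_x (f x)%:E)%E <= M%:E)%E -> L1 f.
Proof.
move=> mf f0 h; apply/integrableP; split; first exact/measurable_EFinP.
under eq_integral do rewrite /= ger0_norm//.
exact: le_lt_trans h (ltry _).
Qed.

Lemma Rint_dct (f_ : nat -> R -> R) f g :
  (forall n, measurable_fun setT (f_ n)) -> measurable_fun setT f -> L1 g ->
  (forall n x, `|f_ n x| <= g x) -> (forall x, f_ n x @[n --> \oo] --> f x) ->
  L1 f /\ \int[mu]_x f_ n x @[n --> \oo] --> \int[mu]_x f x.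
Proof.
move=> mf_ mf ig fg cf.
have h1 n : measurable_fun [set: R] (EFin \o f_ n) by exact/measurable_EFinP.
have h2 : measurable_fun [set: R] (EFin \o f) by exact/measurable_EFinP.
have h3 : {ae mu, forall x, setT x ->
    (EFin \o f_ n) x @[n --> \oo] --> (EFin \o f) x}.
  by apply: aeW => x _; apply/cvg_EFin; [exact: nearW|exact: cf].
have h4 : {ae mu, forall x n, setT x -> (`|(EFin \o f_ n) x| <= (EFin \o g) x)%E}.
  by apply: aeW => x n _ /=; rewrite lee_fin.
have [if1 _ h] := @dominated_convergence _ _ R mu _ measurableT _ _ _ h1 h2 h3 ig h4.
split => //; apply: fine_cvg.
by rewrite EFin_Rint.
Qed.

End Integrals.

(** * Iterated integrals and integrals of derivatives over the line *)

Section Fubini_FTC.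
Context {R : realType}.
Local Notation mu := (@lebesgue_measure R).
Implicit Types (f g : R -> R) (F : R -> R -> R).

(** The extended real integral is a difference of integrals of positive and
    negative parts, each measurable by Tonelli, and [fine] is measurable. *)
Lemma measurable_Rint F : measurable_fun setT (fun z : R * R => F z.1 z.2) ->
  measurable_fun setT (fun x => \int[mu]_y F x y).
Proof.
move=> mF.
have mE : measurable_fun setT (EFin \o (fun z : R * R => F z.1 z.2)).
  exact/measurable_EFinP.
have -> : (fun x => \int[mu]_y F x y) = fine \o
   ((fun x => \int[mu]_y ((EFin \o (fun z : R * R => F z.1 z.2))^\+ (x, y)))
   \- (fun x => \int[mu]_y ((EFin \o (fun z : R * R => F z.1 z.2))^\- (x, y))))%E.
  apply/funext => x; rewrite /Rintegral /=.
  rewrite integralE; congr (fine (_ - _)); apply: eq_integral => y _.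
    by rewrite !funeposE.
  by rewrite !funenegE.
have mP := measurable_fun_fubini_tonelli_F (m2 := mu) _ (measurable_funepos mE)
  (fun x => funepos_ge0 _ _).
have mN := measurable_fun_fubini_tonelli_F (m2 := mu) _ (measurable_funeneg mE)
  (fun x => funeneg_ge0 _ _).
exact: (measurableT_comp (fine_measurable measurableT) (emeasurable_funB mP mN)).
Qed.

(** The bound [G] on one family of sections gives integrability on the plane.
    Sections in the other direction are then integrable only almost everywhere;
    this is harmless since [fine] gives the remaining ones a finite value. *)
Lemma Rint_fubini F (G : R -> R) :
  measurable_fun setT (fun z : R * R => F z.1 z.2) ->
  (forall y, L1 (F^~ y)) -> (forall y, \int[mu]_x `|F x y| <= G y) -> L1 G ->
  [/\ L1 (fun x => \int[mu]_y F x y), L1 (fun y => \int[mu]_x F x y) &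
      \int[mu]_x \int[mu]_y F x y = \int[mu]_y \int[mu]_x F x y].
Proof.
move=> mF iF FG iG; pose f := EFin \o (fun z : R * R => F z.1 z.2).
have mf : measurable_fun setT f by exact/measurable_EFinP.
have intf : (mu \x mu)%E.-integrable setT f.
  apply/(@integrable21ltyP _ _ _ _ _ mu mu _ mf).
  have h : (\int[mu]_y \int[mu]_x `|f (x, y)| <= \int[mu]_y `|(G y)%:E|)%E.
    apply: ge0_le_integral => //.
    - by move=> y _; exact: integral_ge0.
    - exact: (measurable_fun_fubini_tonelli_G (m1 := mu) (abse \o f)
        (measurableT_comp (@abse_measurable _ setT) mf) (fun=> abse_ge0 _)).
    - by apply: measurableT_comp => //; exact: measurable_int iG.
    move=> y _; rewrite [leLHS](_ : _ = (\int[mu]_x `|F x y|)%:E).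
      by rewrite lee_fin (le_trans (FG y))// ler_norm.
    rewrite EFin_Rint; first by [].
    exact: L1_norm.
  by apply: le_lt_trans h _; case/integrableP: iG.
have iF1 := integrable_fubini_F intf.
have aei := ae_integrable1 intf.
have iG1 : mu.-integrable setT (fun y => (\int[mu]_x F x y)%:E).
  apply: (L1_le _ iG).
    apply: (measurable_Rint (F := fun y x => F x y)).
    exact: (measurableT_comp mF (@measurable_swap _ _ R R)).
  by move=> y; rewrite (le_trans (Rint_norm (iF y)))// FG.
have Feq : ae_eq mu setT (fun x => (\int[mu]_y F x y)%:E) (fubini_F mu f).
  apply: ae_imply aei => x /= h _; rewrite /fubini_F EFin_Rint//.
have mF1 : measurable_fun setT (fun x => (\int[mu]_y F x y)%:E).
  by apply/measurable_EFinP; exact: measurable_Rint.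
have iF2 : L1 (fun x => \int[mu]_y F x y).
  case/integrableP: iF1 => mF1' lF1; apply/integrableP; split=> //.
  rewrite (_ : (\int[_]_(_ in _) _)%E = (\int[mu]_x `|fubini_F mu f x|)%E)//.
  apply: ae_eq_integral => //.
  - exact: measurableT_comp.
  - exact: measurableT_comp.
  - by apply: ae_imply Feq => x h Tx; congr abse; exact: h.
split => //.
rewrite {1}/Rintegral (ae_eq_integral _ _ _ _ _ Feq)//; last first.
  exact: measurable_int iF1.
rewrite (@Fubini _ _ _ _ _ mu mu _ intf) [in RHS]/Rintegral; congr fine.
apply: eq_integral => y _.
by rewrite EFin_Rint//; exact: iF.
Qed.

Lemma FTC_segment f (F : R -> R) n : continuous f ->
  (forall x, is_derive x (1:R) F (f x)) ->
  (\int[mu]_(x in `[(- n.+1%:R)%R, n.+1%:R%R]) (f x)%:E =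
    (F n.+1%:R - F (- n.+1%:R))%R%:E)%E.
Proof.
move=> cf dF.
have cF x : {for x, continuous F}.
  by apply: differentiable_continuous; apply/derivable1_diffP; case: (dF x).
rewrite (@continuous_FTC2 _ f F)//.
- by rewrite -subr_gt0 opprK addr_gt0.
- exact: continuous_subspaceT.
- split.
  + by move=> x _; case: (dF x).
  + exact/cvg_at_right_filter/cF.
  + exact/cvg_at_left_filter/cF.
- by move=> x _; rewrite derive1E; case: (dF x).
Qed.

Lemma bigcup_segments : \bigcup_n `[- n.+1%:R, n.+1%:R]%classic = [set: R].
Proof.
rewrite -subTset => x _.
have [n hn] : exists n, `|x| < n.+1%:R.
  exists (Num.trunc `|x|); exact: truncnS_gt.
exists n => //=; rewrite in_itv /= -ler_norml ltW//.
Qed.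

(** The integrals over the segments [-n, n] are differences of values of [F], and
    by monotone convergence they tend to the whole integral. *)
Lemma FTC_ge0_L1 f (F : R -> R) M : continuous f -> (forall x, 0 <= f x) ->
  (forall x, is_derive x (1:R) F (f x)) -> (forall x, `|F x| <= M) -> L1 f.
Proof.
move=> cf f0 dF FM; apply: (@L1_bounded_ge0 _ _ (M + M)) => //.
  exact: continuous_measurable_fun.
rewrite -bigcup_segments.
pose A n := `[- n.+1%:R, n.+1%:R]%classic : set R.
have := @ge0_nondecreasing_set_cvg_integral _ (measurableTypeR R) R A (EFin \o f) mu.
have h1 : nondecreasing_seq A.
  move=> m n mn; apply/subsetPset => x /=; rewrite /A /= !in_itv /= => /andP[h1 h2].
  rewrite (le_trans _ h1) ?(le_trans h2)//.
    by rewrite ler_nat.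
  by rewrite lerN2 ler_nat.
move=> /(_ h1) h.
have {}h := h (fun=> measurable_itv _).
have {}h := h (fun n => measurable_funTS ((@measurable_EFinP _ _ _ setT f).2
  (continuous_measurable_fun cf))).
have {}h := h (fun i x _ => f0 x).
apply: (cvge_to_le h) => //.
apply: nearW => n /=; rewrite (FTC_segment n cf dF) lee_fin.
have := FM n.+1%:R; have := FM (- n.+1%:R); rewrite !ler_norml.
by move=> /andP[? ?] /andP[? ?]; lra.
Qed.

Lemma FTC_Rint f (F : R -> R) l1 l2 : continuous f -> L1 f ->
  (forall x, is_derive x (1:R) F (f x)) ->
  F n.+1%:R @[n --> \oo] --> l2 -> F (- n.+1%:R) @[n --> \oo] --> l1 ->
  \int[mu]_x f x = l2 - l1.
Proof.
move=> cf if1 dF F2 F1.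
pose A n := `[- n.+1%:R, n.+1%:R]%classic : set R.
have mf := L1_measurable if1.
have [] := @Rint_dct R (fun n => f \_ (A n)) f (fun x => `|f x|).
- by move=> n; apply: measurable_fun_patch => //; exact: measurable_itv.
- by [].
- exact: L1_norm.
- by move=> n x; rewrite /patch; case: ifP => // _; rewrite normr0.
- move=> x; apply: cvg_near_cst.
  near=> n; rewrite /patch ifT// inE /A /= in_itv /= -ler_norml.
  near: n; exists (Num.trunc `|x|) => // n /= hn.
  by rewrite (le_trans (ltW (truncnS_gt _)))// ler_nat ltnS.
move=> _ h.
rewrite -(cvg_lim (@Rhausdorff R) h); apply/cvg_lim => //.
suff -> : (fun n => \int[mu]_x (f \_ (A n)) x) = (fun n => F n.+1%:R - F (- n.+1%:R)).
  exact: cvgB.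
by apply/funext => n; rewrite -Rintegral_mkcond /Rintegral (FTC_segment n cf dF).
Unshelve. all: end_near. Qed.

End Fubini_FTC.

(** * The Poisson kernel and its conjugate *)

Section Kernels.
Context {R : realType}.
Local Notation mu := (@lebesgue_measure R).
Implicit Types (a b s t x u : R).

(** pi times the Poisson kernel; the factor is left out so that no constant
    occurs in the partial fractions. *)
Definition pker a u : R := a / (u ^+ 2 + a ^+ 2).

(** pi times the conjugate Poisson kernel, a smooth version of 1 / u. *)
Definition qker a u : R := u / (u ^+ 2 + a ^+ 2).

Lemma den_gt0 a u : 0 < a -> 0 < u ^+ 2 + a ^+ 2.
Proof. by move=> a0; rewrite ltr_wpDl ?sqr_ge0// exprn_gt0. Qed.

Lemma pker_ge0 a u : 0 < a -> 0 <= pker a u.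
Proof. by move=> a0; rewrite divr_ge0 ?ltW ?den_gt0. Qed.

Lemma pkerN a u : pker a (- u) = pker a u.
Proof. by rewrite /pker sqrrN. Qed.

Lemma qkerN a u : qker a (- u) = - qker a u.
Proof. by rewrite /qker sqrrN mulNr. Qed.

Lemma pkerC a x t : pker a (x - t) = pker a (t - x).
Proof. by rewrite -pkerN opprB. Qed.

Lemma qkerC a x t : qker a (x - t) = - qker a (t - x).
Proof. by rewrite -qkerN opprB. Qed.

Lemma sqr_pker_le a u : 0 < a -> pker a u ^+ 2 <= a^-1 * pker a u.
Proof.
move=> a0; have d0 := den_gt0 u a0; rewrite expr2 ler_wpM2r ?pker_ge0//.
by rewrite /pker ler_pdivrMr// mulrDr expr2 [_ * (a * a)]mulrA mulVf ?gt_eqF// mul1r lerDr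
  mulr_ge0 ?sqr_ge0// invr_ge0 ltW.
Qed.

Lemma sqr_qker_le a u : 0 < a -> qker a u ^+ 2 <= a^-1 * pker a u.
Proof.
move=> a0; have d0 := den_gt0 u a0.
rewrite /pker mulrA mulVf ?gt_eqF// mul1r /qker expr_div_n ler_pdivrMr ?exprn_gt0//.
by rewrite [X in _ * X]expr2 mulrA mulVf ?gt_eqF// mul1r lerDl sqr_ge0.
Qed.

Lemma pker_le a u : 0 < a -> pker a u <= a^-1.
Proof.
move=> a0; have := sqr_pker_le u a0; rewrite expr2.
have [->|p0] := eqVneq (pker a u) 0; first by move=> _; rewrite invr_ge0 ltW.
by rewrite ler_pM2r// lt_neqAle eq_sym p0 pker_ge0.
Qed.

Lemma qker_le a u : 0 < a -> `|qker a u| <= a^-1.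
Proof.
move=> a0; rewrite -(@ler_pXn2r _ 2)// ?nnegrE ?invr_ge0 ?(ltW a0)//.
rewrite real_normK ?num_real// (le_trans (sqr_qker_le _ a0))// expr2.
by rewrite ler_wpM2l ?invr_ge0 ?(ltW a0)// pker_le.
Qed.

Lemma continuous_den s a : continuous (fun x => (x - s) ^+ 2 + a ^+ 2 : R).
Proof.
move=> x; apply: cvgD; last exact: cvg_cst.
by apply: (@continuous_comp _ _ _ (fun x => x - s) (fun x => x ^+ 2));
  [apply: cvgB; [exact: cvg_id|exact: cvg_cst]|exact: exprn_continuous].
Qed.

Lemma continuous_pker a s : 0 < a -> continuous (fun x => pker a (x - s)).
Proof.
move=> a0 x; apply: cvgM; first exact: cvg_cst.
by apply: cvgV; [rewrite gt_eqF ?den_gt0|exact: continuous_den].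
Qed.

Lemma continuous_qker a s : 0 < a -> continuous (fun x => qker a (x - s)).
Proof.
move=> a0 x; apply: cvgM; first by apply: cvgB; [exact: cvg_id|exact: cvg_cst].
by apply: cvgV; [rewrite gt_eqF ?den_gt0|exact: continuous_den].
Qed.

Lemma is_derive_atan_pker a s x : 0 < a ->
  is_derive x (1 : R) (fun x => atan ((x - s) / a)) (pker a (x - s)).
Proof.
move=> a0.
have d1 : is_derive x (1 : R) (fun x => (x - s) / a) a^-1.
  have d := is_deriveM (is_deriveB (is_derive_id x (1 : R)) (is_derive_cst s x (1 : R)))
    (is_derive_cst a^-1 x (1 : R)).
  by apply: (is_derive_eq d); rewrite scaler0 add0r subr0 /GRing.scale /= mulr1.
have := @is_derive1_comp R atan (fun x => (x - s) / a) x _ _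
  (is_derive1_atan ((x - s) / a)) d1.
move/is_derive_eq; apply.
rewrite /pker; have := den_gt0 (x - s) a0 => d0; field.
by rewrite !gt_eqF//= addrC.
Qed.

Lemma is_derive_ln_qker a s x : 0 < a ->
  is_derive x (1 : R) (fun x => 2^-1 * ln ((x - s) ^+ 2 + a ^+ 2)) (qker a (x - s)).
Proof.
move=> a0; have d0 := den_gt0 (x - s) a0.
have d1 : is_derive x (1 : R) (fun x => (x - s) ^+ 2 + a ^+ 2) (2 * (x - s)).
  have d := is_deriveD (is_deriveX 2 (is_deriveB (is_derive_id x (1 : R))
    (is_derive_cst s x (1 : R)))) (is_derive_cst (a ^+ 2) x (1 : R)).
  by apply: (is_derive_eq d); rewrite subr0 addr0 /GRing.scale /= mulr1 expr1.
have d2 := @is_derive1_comp R (@ln R) (fun x => (x - s) ^+ 2 + a ^+ 2) x _ _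
  (is_derive1_ln d0) d1.
have := @is_deriveZ _ _ _ (@ln R \o (fun x => (x - s) ^+ 2 + a ^+ 2)) 2^-1 x 1 _ d2.
move/is_derive_eq; apply.
by rewrite /qker /GRing.scale /=; field; rewrite gt_eqF.
Qed.

Lemma cvg_shift_y a s : 0 < a -> (n.+1%:R - s) / a @[n --> \oo] --> +oo.
Proof.
move=> a0; apply/cvgryPge => A; near=> n.
rewrite ler_pdivlMr// lerBrDr.
have -> : n.+1%:R = n%:R + 1 :> R by rewrite -natr1.
by rewrite (@le_trans _ _ n%:R) ?lerDl//; near: n; exact: nbhs_infty_ger.
Unshelve. all: end_near. Qed.

Lemma cvg_atan_right a s : 0 < a ->
  atan ((n.+1%:R - s) / a) @[n --> \oo] --> pi / 2.
Proof.
move=> a0.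
apply: (cvg_comp (fun n : nat => (n.+1%:R - s) / a) (@atan R) (cvg_shift_y s a0)).
exact: cvgy_atan.
Qed.

Lemma cvg_atan_left a s : 0 < a ->
  atan ((- n.+1%:R - s) / a) @[n --> \oo] --> - (pi / 2).
Proof.
move=> a0; rewrite (_ : (fun n : nat => _) = fun n => - atan ((n.+1%:R - - s) / a)).
  2: by apply/funext => n; rewrite opprK -atanN -mulNr opprD.
by apply: cvgN; exact: cvg_atan_right.
Qed.

Lemma pker_L1 a s : 0 < a -> L1 (fun x => pker a (x - s)).
Proof.
move=> a0; apply: (@FTC_ge0_L1 R _ (fun x => atan ((x - s) / a)) (pi / 2)).
- exact: continuous_pker.
- by move=> x; exact: pker_ge0.
- by move=> x; exact: is_derive_atan_pker.
- by move=> x; rewrite ler_norml !ltW ?atan_gtNpi2 ?atan_ltpi2.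
Qed.

Lemma Rint_pker a s : 0 < a -> \int[mu]_x pker a (x - s) = pi.
Proof.
move=> a0; transitivity (pi / 2 - - (pi / 2) : R); last by rewrite opprK -splitr.
apply: (@FTC_Rint R _ (fun x => atan ((x - s) / a))).
- exact: continuous_pker.
- exact: pker_L1.
- by move=> x; exact: is_derive_atan_pker.
- exact: cvg_atan_right.
- exact: cvg_atan_left.
Qed.

Lemma pker_L2 a s : 0 < a -> L2 (fun x => pker a (x - s)).
Proof.
move=> a0; have m := continuous_measurable_fun (continuous_pker (s := s) a0).
split=> //; apply: (L1_le _ (L1Z a^-1 (pker_L1 s a0))); first exact: measurable_funX.
by move=> x; rewrite ger0_norm ?sqr_ge0 ?sqr_pker_le.
Qed.

Lemma qker_L2 a s : 0 < a -> L2 (fun x => qker a (x - s)).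
Proof.
move=> a0; have m := continuous_measurable_fun (continuous_qker (s := s) a0).
split=> //; apply: (L1_le _ (L1Z a^-1 (pker_L1 s a0))); first exact: measurable_funX.
by move=> x; rewrite ger0_norm ?sqr_ge0 ?sqr_qker_le.
Qed.

Lemma Rint_sqr_qker_le a s : 0 < a ->
  \int[mu]_x (qker a (x - s) ^+ 2) <= a^-1 * pi.
Proof.
move=> a0; rewrite -(Rint_pker s a0) -RintZ; last exact: pker_L1.
apply: Rint_le; [by case: (qker_L2 s a0)|exact: (L1Z _ (pker_L1 s a0))|].
by move=> x; exact: sqr_qker_le.
Qed.

Lemma Rint_sqr_pker_le a s : 0 < a ->
  \int[mu]_x (pker a (x - s) ^+ 2) <= a^-1 * pi.
Proof.
move=> a0; rewrite -(Rint_pker s a0) -RintZ; last exact: pker_L1.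
apply: Rint_le; [by case: (pker_L2 s a0)|exact: (L1Z _ (pker_L1 s a0))|].
by move=> x; exact: sqr_pker_le.
Qed.

(** The difference is half the logarithm of a quotient of two quadratic
    polynomials in [w n] with the same leading coefficient. *)
Lemma cvg_ln_ratio (w : nat -> R) a b s t : 0 < a -> 0 < b ->
  (forall n, w n != 0) -> (w n)^-1 @[n --> \oo] --> 0 ->
  2^-1 * ln ((w n - s) ^+ 2 + a ^+ 2) - 2^-1 * ln ((w n - t) ^+ 2 + b ^+ 2)
    @[n --> \oo] --> 0.
Proof.
move=> a0 b0 w0 cw.
have E n : 2^-1 * ln ((w n - s) ^+ 2 + a ^+ 2) - 2^-1 * ln ((w n - t) ^+ 2 + b ^+ 2)
  = 2^-1 * ln (((1 - s * (w n)^-1) ^+ 2 + (a * (w n)^-1) ^+ 2)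
    / ((1 - t * (w n)^-1) ^+ 2 + (b * (w n)^-1) ^+ 2)).
  rewrite -mulrBr -ln_div ?posrE ?den_gt0//; congr (_ * ln _).
  have := den_gt0 (w n - t) b0 => d0; field.
  by rewrite w0 gt_eqF.
under eq_fun do rewrite E.
have -> : 0 = 2^-1 * ln 1 :> R by rewrite ln1 mulr0.
apply: cvgM; first exact: cvg_cst.
apply: (continuous_cvg _ (continuous_ln _)); first exact: ltr01.
have h c : c * (w n)^-1 @[n --> \oo] --> 0.
  have -> : 0 = c * 0 :> R by rewrite mulr0.
  by apply: cvgM => //; exact: cvg_cst.
have h2 c d : (1 - c * (w n)^-1) ^+ 2 + (d * (w n)^-1) ^+ 2 @[n --> \oo] --> (1 : R).
  have h3 : (1 - c * (w n)^-1) * (1 - c * (w n)^-1)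
      + (d * (w n)^-1) * (d * (w n)^-1) @[n --> \oo] --> ((1 - 0) * (1 - 0) + 0 * 0 : R).
    by apply: cvgD; apply: cvgM => //; apply: cvgB => //; exact: cvg_cst.
  by move: h3; rewrite subr0 mulr1 mulr0 addr0.
have := cvgM (h2 s a) (cvgV (oner_neq0 R) (h2 t b)).
by rewrite invr1 mulr1; apply.
Qed.

(** The primitive consists of two arctangents and a difference of logarithms.
    The two conjugate kernels carry opposite coefficients, which is what makes
    the logarithms cancel at both ends. *)
Lemma Rint_partial_fractions f a b s t (A B C : R) : 0 < a -> 0 < b -> L1 f ->
  (forall x, f x = A * pker a (x - s) + C * pker b (x - t)
                   + B * (qker a (x - s) - qker b (x - t))) ->
  \int[mu]_x f x = pi * (A + C).
Proof.
move=> a0 b0 if1 E.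
have -> : pi * (A + C) = (A * (pi / 2) + C * (pi / 2) + B * 0)
  - (A * - (pi / 2) + C * - (pi / 2) + B * 0).
  by field.
have {}E : f = (fun x => A * pker a (x - s) + C * pker b (x - t)
                   + B * (qker a (x - s) - qker b (x - t))).
  exact/funext.
have cinv : (n.+1%:R : R)^-1 @[n --> \oo] --> (0 : R) by exact: cvg_harmonic.
apply: (@FTC_Rint R f (fun x => A * atan ((x - s) / a) + C * atan ((x - t) / b)
  + B * (2^-1 * ln ((x - s) ^+ 2 + a ^+ 2) - 2^-1 * ln ((x - t) ^+ 2 + b ^+ 2)))).
- rewrite E => x; apply: cvgD; first apply: cvgD; apply: cvgM; try exact: cvg_cst.
  + exact: continuous_pker.
  + exact: continuous_pker.
  + by apply: cvgB; exact: continuous_qker.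
- exact: if1.
- move=> x; rewrite E.
  have d1 := is_derive_atan_pker s x a0.
  have d2 := is_derive_atan_pker t x b0.
  have d3 := is_derive_ln_qker s x a0.
  have d4 := is_derive_ln_qker t x b0.
  have := is_deriveD (is_deriveD (is_deriveZ A d1) (is_deriveZ C d2))
    (is_deriveZ B (is_deriveB d3 d4)).
  by [].
- apply: cvgD; first apply: cvgD; apply: cvgM; try exact: cvg_cst.
  + exact: cvg_atan_right.
  + exact: cvg_atan_right.
  + by apply: (@cvg_ln_ratio (fun n => n.+1%:R)).
- apply: cvgD; first apply: cvgD; apply: cvgM; try exact: cvg_cst.
  + exact: cvg_atan_left.
  + exact: cvg_atan_left.
  + apply: (@cvg_ln_ratio (fun n => - n.+1%:R)) => //.
    suff : (- n.+1%:R^-1 : R) @[n --> \oo] --> (- 0 : R) by rewrite oppr0; under eq_fun do rewrite -invrN.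
    exact: cvgN.
Qed.

(** With C_a = p_a + i q_a = 1 / (a - i u), the coefficients come from the
    partial fractions of C_a(x - s) C_b(x - t) and of C_a(x - s) times the
    conjugate of C_b(x - t): the denominators are b - a - i d and a + b + i d,
    where d = s - t, and [D] and [S] are their squared moduli.  The first one
    vanishes for a = b and d = 0, whence the hypothesis [s != t]. *)
Lemma Rint_qker_qker a b s t : 0 < a -> 0 < b -> s != t ->
  \int[mu]_x (qker a (x - s) * qker b (x - t)) = pi * pker (a + b) (s - t).
Proof.
move=> a0 b0 st; set d := s - t; pose S := (a + b) ^+ 2 + d ^+ 2.
pose D := (b - a) ^+ 2 + d ^+ 2.
have d0 : d != 0 by rewrite subr_eq0.
have dd : 0 < d ^+ 2 by rewrite exprn_even_gt0.
have S0 : S != 0 by rewrite gt_eqF// ltr_wpDl// sqr_ge0.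
have D0 : D != 0 by rewrite gt_eqF// ltr_wpDl// sqr_ge0.
have -> : pker (a + b) d = ((a + b) / S - (b - a) / D) / 2 + ((a + b) / S + (b - a) / D) / 2.
  rewrite /pker [d ^+ 2 + _]addrC -/S; field; by rewrite S0 D0.
apply: (@Rint_partial_fractions _ a b s t _ ((d / S + d / D) / 2)) => //.
  by apply: L2_mul; exact: qker_L2.
move=> x; have -> : x - t = (x - s) + d by rewrite /d; ring.
have := den_gt0 (x - s) a0; have := den_gt0 (x - s + d) b0.
move: (x - s) => u; rewrite /pker /qker => h1 h2.
move: S0 D0; rewrite /S /D => S0 D0; field.
by rewrite S0 D0 !gt_eqF.
Qed.

(** Imaginary parts of the same two partial fractions as in
    [Rint_qker_qker]. *)
Lemma Rint_pker_qker a b s t : 0 < a -> 0 < b -> s != t ->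
  \int[mu]_x (pker a (x - s) * qker b (x - t)) = pi * qker (a + b) (s - t).
Proof.
move=> a0 b0 st; set d := s - t; pose S := (a + b) ^+ 2 + d ^+ 2.
pose D := (b - a) ^+ 2 + d ^+ 2.
have d0 : d != 0 by rewrite subr_eq0.
have dd : 0 < d ^+ 2 by rewrite exprn_even_gt0.
have S0 : S != 0 by rewrite gt_eqF// ltr_wpDl// sqr_ge0.
have D0 : D != 0 by rewrite gt_eqF// ltr_wpDl// sqr_ge0.
have -> : qker (a + b) d = (d / D + d / S) / 2 + (d / S - d / D) / 2.
  rewrite /qker [d ^+ 2 + _]addrC -/S; field; by rewrite S0 D0.
apply: (@Rint_partial_fractions _ a b s t _ (((b - a) / D - (a + b) / S) / 2)) => //.
  by apply: L2_mul; [exact: pker_L2|exact: qker_L2].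
move=> x; have -> : x - t = (x - s) + d by rewrite /d; ring.
have := den_gt0 (x - s) a0; have := den_gt0 (x - s + d) b0.
move: (x - s) => u; rewrite /pker /qker => h1 h2.
move: S0 D0; rewrite /S /D => S0 D0; field.
by rewrite S0 D0 !gt_eqF.
Qed.

End Kernels.

(** * Completeness of the space of square integrable functions *)

Section SquareIntegrable.
Context {R : realType}.
Local Notation mu := (@lebesgue_measure R).
Implicit Types f g h : R -> R.

Lemma Rint_fatou (f_ : nat -> R -> R) f M :
  (forall n x, 0 <= f_ n x) -> (forall n, L1 (f_ n)) ->
  (forall x, f_ n x @[n --> \oo] --> f x) ->
  (forall n, \int[mu]_x f_ n x <= M) -> L1 f /\ \int[mu]_x f x <= M.
Proof.
move=> f0 if_ cf fM.
have mf : measurable_fun setT f.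
  by apply: (measurable_fun_cvg (h := f_)) => [n|x _]; [exact: L1_measurable|exact: cf].
have fx0 x : 0 <= f x.
  by rewrite -(cvg_lim (@Rhausdorff R) (cf x)); apply: limr_ge;
    [apply/cvg_ex; exists (f x)|exact: nearW].
have hM : (\int[mu]_x (f x)%:E <= M%:E)%E.
  have := @fatou _ _ R mu setT measurableT (fun n x => (f_ n x)%:E)
    (fun n => measurable_int _ (if_ n)) (fun n x _ => f0 n x).
  have -> : (\int[mu]_x limn_einf (fun n => (f_ n x)%:E) = \int[mu]_x (f x)%:E)%E.
    apply: eq_integral => x _.
    have c : (f_ n x)%:E @[n --> \oo] --> (f x)%:E.
      by apply/cvg_EFin; [exact: nearW|exact: cf].
    by rewrite (cvg_limn_einf_sup c).1.
  move=> /le_trans; apply.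
  rewrite limn_einf_lim; apply: lime_le; first exact: is_cvg_einfs.
  apply: nearW => n; apply: le_trans (_ : _ <= (\int[mu]_x f_ n x)%:E)%E _.
    rewrite EFin_Rint//; apply: ereal_inf_lbound; exists n => //=.
  by rewrite lee_fin.
have i1 := L1_bounded_ge0 mf fx0 hM.
by split => //; rewrite -lee_fin EFin_Rint.
Qed.

(** The quadratic polynomial in [c] given by the integral of (k - c)^2 h is
    nonnegative, hence so is minus its discriminant. *)
Lemma weighted_cauchy_schwarz (k h : R -> R) : (forall x, 0 <= h x) -> L1 h ->
  L1 (fun x => k x * h x) -> L1 (fun x => k x ^+ 2 * h x) ->
  (\int[mu]_x (k x * h x)) ^+ 2 <= (\int[mu]_x h x) * \int[mu]_x (k x ^+ 2 * h x).
Proof.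
move=> h0 ih ikh ik2h.
set H := \int[mu]_x h x; set B := \int[mu]_x (k x * h x).
set A := \int[mu]_x (k x ^+ 2 * h x).
have quad c : 0 <= A - 2 * c * B + c ^+ 2 * H.
  have -> : A - 2 * c * B + c ^+ 2 * H =
      \int[mu]_x (k x ^+ 2 * h x - (2 * c) * (k x * h x) + c ^+ 2 * h x).
    rewrite RintD; [|by apply: L1B => //; exact: L1Z|exact: L1Z].
    by rewrite RintB ?RintZ//; exact: L1Z.
  apply: Rint_ge0 => x.
  rewrite (_ : _ + _ = (k x - c) ^+ 2 * h x); last by ring.
  by rewrite mulr_ge0 ?sqr_ge0.
have H0 : 0 <= H by exact: Rint_ge0.
have [H1|H1] := ltP 0 H.
  have := quad (B / H).
  have -> : A - 2 * (B / H) * B + (B / H) ^+ 2 * H = (H * A - B ^+ 2) / H.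
    by field; rewrite gt_eqF.
  by rewrite pmulr_lge0 ?invr_gt0// subr_ge0.
have {H0}{H1} HE : H = 0 by apply/eqP; rewrite eq_le H1 H0.
rewrite HE mul0r; have [->|B0] := eqVneq B 0; first by rewrite expr0n.
have := quad ((A + 1) / (2 * B)).
rewrite HE (_ : _ + _ = -1); last by field.
by rewrite lerNr oppr0 ler10.
Qed.

(** The free parameter [l] replaces square roots: small [l] lets one of the two
    factors be large when the other one is small. *)
Lemma le_Rint_mul f g (l : R) : 0 < l -> L2 f -> L2 g ->
  `|\int[mu]_x (f x * g x)| <=
     2^-1 * (l * \int[mu]_x (f x ^+ 2) + l^-1 * \int[mu]_x (g x ^+ 2)).
Proof.
move=> l0 l2f l2g; have if2 := l2f.2; have ig2 := l2g.2.
rewrite (le_trans (Rint_norm (L2_mul l2f l2g)))//.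
rewrite -!RintZ// -RintD; [|exact: L1Z..].
rewrite -RintZ; last by apply: L1D; exact: L1Z.
apply: Rint_le; first exact: (L1_norm (L2_mul l2f l2g)).
  by apply: L1Z; apply: L1D; exact: L1Z.
move=> x; have h1 := sqr_ge0 (l * f x + g x); have h2 := sqr_ge0 (l * f x - g x).
have h3 : `|f x * g x| * (2 * l) <= l ^+ 2 * f x ^+ 2 + g x ^+ 2.
  have [_|_] := ger0P (f x * g x).
    move: h2; rewrite sqrrB exprMn -mulr_natl; lra.
  move: h1; rewrite sqrrD exprMn -mulr_natl; lra.
rewrite -(ler_pM2r (_ : 0 < 2 * l)) ?mulr_gt0// (le_trans h3)//.
rewrite le_eqVlt; apply/orP; left; apply/eqP; field; by rewrite gt_eqF.
Qed.

(** The argument of Riesz and Fischer.  Increments d_k of size 2^-k in norm make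
    the sum W of the 2^k d_k^2 integrable, hence finite almost everywhere, and
    there 2 |d_k| <= 2^k d_k^2 + 2^-k shows that the sequence converges
    absolutely.  By Fatou, the limit is also a limit in norm.  Only the weak
    consequence is recorded. *)
Lemma L2_complete (f_ : nat -> R -> R) (C : R) :
  (forall n, L2 (f_ n)) ->
  (forall k j, (k <= j)%N -> \int[mu]_x ((f_ j x - f_ k x) ^+ 2) <= C * (4^-1) ^+ k) ->
  exists2 h, L2 h & forall u, L2 u ->
    \int[mu]_x (u x * f_ n x) @[n --> \oo] --> \int[mu]_x (u x * h x).
Proof.
move=> l2f hC.
have C0 : 0 <= C.
  have := hC 0%N 0%N (leqnn _); rewrite expr0 mulr1; apply: le_trans.
  by apply: Rint_ge0 => x; exact: sqr_ge0.
have mf n : measurable_fun setT (f_ n) by exact: L2_measurable.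
pose w k x := 2 ^+ k * (f_ k.+1 x - f_ k x) ^+ 2.
have w0 k x : 0 <= w k x by rewrite mulr_ge0 ?sqr_ge0// exprn_ge0.
have iw k : L1 (w k) by apply: L1Z; exact: (L2B (l2f _) (l2f _)).2.
have wC k : \int[mu]_x w k x <= C * (2^-1) ^+ k.
  rewrite RintZ; last exact: (L2B (l2f _) (l2f _)).2.
  rewrite (le_trans (ler_wpM2l (exprn_ge0 _ _) (hC k k.+1 (leqnSn _))))//.
  rewrite mulrCA -exprMn (_ : 2 * 4^-1 = 2^-1 :> R)//; by field.
pose W x := (\sum_(0 <= k <oo) (w k x)%:E)%E.
have mw k : measurable_fun setT (EFin \o w k) by exact: measurable_int (iw k).
have mW : measurable_fun setT W.
  have := @ge0_emeasurable_sum _ _ R setT (fun k x => (w k x)%:E) xpredT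
    (fun k x _ _ => w0 k x) (fun k _ => mw k).
  by apply: eq_measurable_fun => x _; apply: eq_eseriesl.
have W0 x : (0 <= W x)%E by apply: nneseries_ge0 => k _ _; rewrite lee_fin.
have iW : mu.-integrable setT W.
  apply/integrableP; split => //.
  under eq_integral do rewrite gee0_abs//.
  rewrite integral_nneseries//; last by move=> k x _; rewrite lee_fin.
  apply: (@le_lt_trans _ _ (\sum_(0 <= k <oo) (C * (2^-1) ^+ k)%:E)%E).
    apply: lee_nneseries => [k _ _|k _].
      by apply: integral_ge0 => x _; rewrite lee_fin.
    by rewrite -EFin_Rint// lee_fin.
  apply: (@le_lt_trans _ _ (C / (1 - 2^-1))%:E); last exact: ltry.
  apply: lime_le; first by apply: is_cvg_nneseries => k _ _; rewrite lee_fin mulr_ge0// exprn_ge0.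
  apply: nearW => n; rewrite sumEFin lee_fin.
  by apply: (@geometric_le_lim R n C 2^-1) => //; rewrite ger0_norm//; lra.
(* Off [D] the functions are replaced by 0, so that the limit exists at
   every point. *)
pose D := [set x : R | W x \is a fin_num].
have mD : measurable D.
  by have := emeasurable_fin_num measurableT mW; rewrite setTI.
have aeD : {ae mu, forall x, D x}.
  by apply: ae_imply (integrable_ae measurableT iW) => x; apply.
pose g_ n := f_ n \_ D.
have mg n : measurable_fun setT (g_ n) by exact: measurable_fun_patch.
have fg n : {ae mu, forall x, f_ n x = g_ n x}.
  by apply: ae_imply aeD => x Dx; rewrite /g_ patchT// inE.
have cg x : cvgn (g_ ^~ x).
  have [Dx|nDx] := pselect (D x); last first.
    apply: (cvgP 0); apply: cvg_near_cst; apply: nearW => n.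
    by rewrite /g_ patchC// inE.
  have -> : g_ ^~ x = f_ ^~ x by apply/funext => n; rewrite /g_ patchT// inE.
  rewrite (_ : f_ ^~ x = (fun n => f_ 0%N x + series (telescope (f_ ^~ x)) n)); last first.
    by apply/funext => n; rewrite -eq_sum_telescope.
  apply: is_cvgD; first exact: is_cvg_cst.
  apply: normed_cvg; apply: nondecreasing_is_cvgn.
    by apply: nondecreasing_series => k _ _; exact: normr_ge0.
  exists (2^-1 * (fine (W x) + 1 / (1 - 2^-1))) => _ [n _ <-] /=.
  have wn : \sum_(0 <= k < n) w k x <= fine (W x).
    rewrite -lee_fin fineK// -sumEFin.
    by apply: nneseries_lim_ge => k _ _; rewrite lee_fin.
  have gn : \sum_(0 <= k < n) (2^-1) ^+ k <= 1 / (1 - 2^-1) :> R.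
    have := @geometric_le_lim R n 1 2^-1 ler01.
    rewrite /series /geometric /=.
    under eq_bigr do rewrite mul1r.
    by apply => //; rewrite ger0_norm//; lra.
  apply: le_trans (ler_wpM2l _ (lerD wn gn)); last by [].
  rewrite /series /= -big_split /= mulr_sumr; apply: ler_sum => k _.
  rewrite /telescope /w; set d := f_ k.+1 x - f_ k x.
  have p0 : 0 < 2 ^+ k :> R by rewrite exprn_gt0.
  rewrite exprVn -(ler_pM2r p0).
  have -> : 2^-1 * (2 ^+ k * d ^+ 2 + (2 ^+ k)^-1) * 2 ^+ k
     = 2^-1 * ((2 ^+ k * `|d|) ^+ 2 + 1).
    rewrite exprMn real_normK ?num_real//; field; by rewrite gt_eqF.
  have := sqr_ge0 (2 ^+ k * `|d| - 1); rewrite sqrrB1 -mulr_natl; lra.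
pose h x := limn (g_ ^~ x).
have ch x : g_ n x @[n --> \oo] --> h x by exact: cg.
have l2g n : L2 (g_ n).
  split => //; apply: L1_ae (l2f n).2 _; first exact: measurable_funX.
  by apply: ae_imply (fg n) => x ->.
have gC k j : (k <= j)%N -> \int[mu]_x ((g_ j x - g_ k x) ^+ 2) <= C * (4^-1) ^+ k.
  move=> kj; apply: le_trans (hC k j kj); rewrite le_eqVlt; apply/orP; left; apply/eqP.
  apply: eq_Rint_ae; [| |apply: ae_imply (ae_and (fg k) (fg j)) => x [-> ->]//].
    by apply: measurable_funX; exact: measurable_funB.
  by apply: measurable_funX; exact: measurable_funB.
have mh : measurable_fun setT h.
  by apply: (measurable_fun_cvg (h := g_)) => [n|x _]; [exact: mg|exact: ch].
have hh k : L1 (fun x => (h x - g_ k x) ^+ 2) /\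
    \int[mu]_x ((h x - g_ k x) ^+ 2) <= C * (4^-1) ^+ k.
  apply: (@Rint_fatou (fun n x => (g_ (n + k)%N x - g_ k x) ^+ 2)).
  - by move=> n x; exact: sqr_ge0.
  - by move=> n; exact: (L2B (l2g _) (l2g _)).2.
  - move=> x; apply: (@continuous_cvg _ _ _ _ _ _ (fun y : R => y ^+ 2)).
      exact: exprn_continuous.
    apply: cvgB; last exact: cvg_cst.
    by have := ch x; rewrite -(cvg_shiftn k).
  - by move=> n; apply: gC; exact: leq_addl.
have l2hg k : L2 (fun x => h x - g_ k x).
  by split; [exact: measurable_funB|exact: (hh k).1].
have l2h : L2 h.
  have := L2B (l2hg 0%N) (L2Z (-1) (l2g 0%N)).
  by rewrite (_ : (fun x => _) = h)//; apply/funext => x; ring.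
exists h => // u l2u.
have E n : \int[mu]_x (u x * f_ n x) = \int[mu]_x (u x * g_ n x).
  apply: eq_Rint_ae; [| |by apply: ae_imply (fg n) => x ->].
    by apply: measurable_funM => //; exact: L2_measurable.
  by apply: measurable_funM => //; exact: L2_measurable.
under eq_fun do rewrite E.
apply/cvgrPdist_le => e e0.
have B n : `|\int[mu]_x (u x * h x) - \int[mu]_x (u x * g_ n x)| <=
    2^-1 * (\int[mu]_x (u x ^+ 2) + C) * (2^-1) ^+ n.
  rewrite -RintB; [|exact: L2_mul..].
  rewrite (eq_Rint (g := fun x => u x * (h x - g_ n x))); last by move=> x; rewrite mulrBr.
  (* The weight 2^-n balances the bounded energy of [u] against the distance
     4^-n of the square norms. *)
  have p0 : 0 < (2^-1) ^+ n :> R by rewrite exprn_gt0.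
  rewrite (le_trans (le_Rint_mul p0 l2u (l2hg n)))// -mulrA ler_pM2l//.
  rewrite mulrDl [_ * 2^-1 ^+ n]mulrC lerD2l.
  rewrite -[leRHS]mulrC -exprVn invrK.
  rewrite (le_trans (ler_wpM2l (exprn_ge0 _ _) (hh n).2))//.
  rewrite mulrCA -exprMn (_ : 2 * 4^-1 = 2^-1 :> R) 1?mulrC//; by field.
near=> n; apply: le_trans (B n) _.
near: n.
have cge : (2^-1 * (\int[mu]_x (u x ^+ 2) + C) * (2^-1) ^+ n) @[n --> \oo] --> (0 : R).
  by apply: cvg_geometric; rewrite ger0_norm//; lra.
by have /cvgrPdist_le/(_ _ e0) := cge; apply: filterS => n; rewrite sub0r normrN;
  apply: le_trans; exact: ler_norm.
Unshelve. all: end_near. Qed.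

End SquareIntegrable.

(** * The boundary value of the conjugate Poisson integral *)

Section Convolution.
Context {R : realType}.
Local Notation mu := (@lebesgue_measure R).
Implicit Types (K f g h : R -> R) (a b c s t x : R).

Definition convol K f x : R := \int[mu]_t (K (x - t) * f t).

(** What convolution with an L1 function needs from a kernel.  The conjugate
    Poisson kernel is not integrable, hence the bounds on its square. *)
Definition tame K : Prop :=
  [/\ measurable_fun setT K, exists B, forall u, `|K u| <= B,
      forall s, L2 (fun x => K (x - s)) &
      exists M, forall s, \int[mu]_x (K (x - s) ^+ 2) <= M].

Lemma tame_pker a : 0 < a -> tame (pker a).
Proof.
move=> a0; split.
- have := continuous_measurable_fun (continuous_pker (s := 0) a0).
  by apply: eq_measurable_fun => x _; rewrite subr0.
- by exists a^-1 => u; rewrite ger0_norm ?pker_ge0 ?pker_le.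
- by move=> s; exact: pker_L2.
- by exists (a^-1 * pi) => s; exact: Rint_sqr_pker_le.
Qed.

Lemma tame_qker a : 0 < a -> tame (qker a).
Proof.
move=> a0; split.
- have := continuous_measurable_fun (continuous_qker (s := 0) a0).
  by apply: eq_measurable_fun => x _; rewrite subr0.
- by exists a^-1 => u; exact: qker_le.
- by move=> s; exact: qker_L2.
- by exists (a^-1 * pi) => s; exact: Rint_sqr_qker_le.
Qed.

Lemma measurable_kernel2 K f : measurable_fun setT K -> measurable_fun setT f ->
  measurable_fun setT (fun z : R * R => K (z.1 - z.2) * f z.2).
Proof.
move=> mK mf; apply: measurable_funM.
  apply: (measurableT_comp mK).
  by apply: measurable_funB; [exact: measurable_fst|exact: measurable_snd].
exact: (measurableT_comp mf (@measurable_snd _ _ R R)).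
Qed.

Lemma measurable_conv K f : measurable_fun setT K -> measurable_fun setT f ->
  measurable_fun setT (convol K f).
Proof.
move=> mK mf.
exact: (measurable_Rint (F := fun x t => K (x - t) * f t) (measurable_kernel2 mK mf)).
Qed.

Lemma measurable_section K x : measurable_fun setT K ->
  measurable_fun setT (fun t => K (x - t)).
Proof. by move=> mK; apply: (measurableT_comp mK); exact: measurable_funB. Qed.

Lemma L1_bounded_mul (k : R -> R) f (B : R) : measurable_fun setT k ->
  (forall x, `|k x| <= B) -> L1 f -> L1 (fun x => k x * f x).
Proof.
move=> mk kB if1; apply: (L1_le _ (L1Z B (L1_norm if1))).
  by apply: measurable_funM => //; exact: L1_measurable.
by move=> x; rewrite normrM ler_wpM2r.
Qed.

Lemma tame_section_L1 K f x : tame K -> L1 f -> L1 (fun t => K (x - t) * f t).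
Proof.
move=> [mK [B KB] _ _]; apply: L1_bounded_mul; first exact: measurable_section.
by move=> t; exact: KB.
Qed.

(** Cauchy-Schwarz with weight |f| bounds the square of the convolution by
    |f|_1 times the convolution of K^2 with |f|, which is integrable. *)
Lemma conv_L2 K f : tame K -> L1 f -> L2 (convol K f).
Proof.
move=> tK if1; have [mK [B KB] K2 [M KM]] := tK.
have mf := L1_measurable if1.
have ina : L1 (fun t => `|f t|) by exact: L1_norm.
pose F x t := K (x - t) ^+ 2 * `|f t|.
have [iV _ _] : [/\ L1 (fun x => \int[mu]_t F x t), L1 (fun t => \int[mu]_x F x t) &
    \int[mu]_x \int[mu]_t F x t = \int[mu]_t \int[mu]_x F x t].
  apply: (@Rint_fubini _ F (fun t => M * `|f t|)).
  - apply: (measurable_kernel2 (K := fun u => K u ^+ 2) (f := fun t => `|f t|)).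
      exact: measurable_funX.
    exact: L1_measurable.
  - move=> t; apply: eq_integrable (L1Z `|f t| (K2 t).2) => // x _ /=.
    by rewrite mulrC.
  - move=> t; rewrite (eq_Rint (g := fun x => `|f t| * K (x - t) ^+ 2)); last first.
      by move=> x; rewrite /F normrM normr_id (ger0_norm (sqr_ge0 _)) mulrC.
    rewrite RintZ; last exact: (K2 t).2.
    by rewrite mulrC ler_wpM2r.
  - exact: L1Z.
have mc := measurable_conv mK mf.
split => //; apply: (L1_le _ (L1Z (\int[mu]_t `|f t|) iV)); first exact: measurable_funX.
move=> x; rewrite ger0_norm ?sqr_ge0//.
have h1 : L1 (fun t => `|K (x - t)| * `|f t|).
  by apply: eq_integrable (L1_norm (tame_section_L1 x tK if1)) => // t _ /=; rewrite normrM.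
have h2 : L1 (fun t => `|K (x - t)| ^+ 2 * `|f t|).
  apply: (@L1_bounded_mul _ _ (B ^+ 2)) => //.
    by apply: measurable_funX; apply: measurableT_comp => //; exact: measurable_section.
  by move=> t; rewrite normrX normr_id lerXn2r ?nnegrE// (le_trans _ (KB (x - t))).
have := weighted_cauchy_schwarz (fun t => normr_ge0 (f t)) ina h1 h2.
rewrite (eq_Rint (f := fun t => `|K (x - t)| ^+ 2 * `|f t|) (g := F x)); last first.
  by move=> t; rewrite /F real_normK ?num_real.
apply: le_trans; rewrite -(real_normK (num_real (convol K f x))).
rewrite lerXn2r ?nnegrE//; first by apply: Rint_ge0 => t; rewrite mulr_ge0.
rewrite (le_trans (Rint_norm (tame_section_L1 x tK if1)))//.
by rewrite (eq_Rint (g := fun t => `|K (x - t)| * `|f t|))// => t; rewrite normrM.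
Qed.

(** The adjoint of a convolution, by Fubini: the sections in [x] of the double
    integrand are bounded, uniformly up to the factor |f t|, thanks to the
    uniform bound on the L2 norms of the translates of [K]. *)
Lemma Rint_mul_conv K f (u : R -> R) : tame K -> L1 f -> L2 u ->
  L1 (fun t => f t * \int[mu]_x (K (x - t) * u x)) /\
  \int[mu]_x (u x * convol K f x) =
  \int[mu]_t (f t * \int[mu]_x (K (x - t) * u x)).
Proof.
move=> tK if1 l2u; have [mK [B KB] K2 [M KM]] := tK.
have mf := L1_measurable if1; have muf := L2_measurable l2u.
pose F x t := u x * (K (x - t) * f t).
have iu t : L1 (fun x => K (x - t) * u x) by exact: L2_mul.
have FE t : (fun x => F x t) = (fun x => f t * (K (x - t) * u x)).
  by apply/funext => x; rewrite /F; ring.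
have [_ iG E] : [/\ L1 (fun x => \int[mu]_t F x t), L1 (fun t => \int[mu]_x F x t) &
    \int[mu]_x \int[mu]_t F x t = \int[mu]_t \int[mu]_x F x t].
  apply: (@Rint_fubini _ F (fun t => 2^-1 * (M + \int[mu]_x (u x ^+ 2)) * `|f t|)).
  - apply: measurable_funM; last exact: measurable_kernel2.
    exact: (measurableT_comp muf (@measurable_fst _ _ R R)).
  - by move=> t; rewrite FE; exact: L1Z.
  - move=> t; rewrite (eq_Rint (g := fun x => `|f t| * `|K (x - t) * u x|)); last first.
      by move=> x; rewrite -normrM; congr (`|_|); rewrite /F; ring.
    rewrite RintZ; last exact: L1_norm.
    rewrite mulrC ler_wpM2r//.
    have Ku : L2 (fun x => `|K (x - t)|).
      apply: (L2_le _ (K2 t)); last by move=> x; rewrite normr_id.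
      by apply: measurableT_comp => //; case: (K2 t).
    have uu : L2 (fun x => `|u x|).
      apply: (L2_le _ l2u); last by move=> x; rewrite normr_id.
      exact: measurableT_comp.
    rewrite (eq_Rint (g := fun x => `|K (x - t)| * `|u x|)); last by move=> x; rewrite normrM.
    rewrite (le_trans (ler_norm _))// (le_trans (le_Rint_mul ltr01 Ku uu))//.
    rewrite invr1 !mul1r ler_pM2l// lerD//.
      rewrite (le_trans _ (KM t))// le_eqVlt; apply/orP; left; apply/eqP.
      by apply: eq_Rint => x; rewrite real_normK ?num_real.
    rewrite le_eqVlt; apply/orP; left; apply/eqP.
    by apply: eq_Rint => x; rewrite real_normK ?num_real.
  - by apply: L1Z; exact: L1_norm.
have GE : (fun t => \int[mu]_x F x t) = (fun t => f t * \int[mu]_x (K (x - t) * u x)).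
  by apply/funext => t; rewrite FE RintZ.
rewrite -GE; split => //; rewrite -E; apply: eq_Rint => x.
by rewrite RintZ//; exact: tame_section_L1.
Qed.

(** The semigroup identity q_a * q_b = - pi p_(a+b) applied to [f]; the sign is
    absorbed by q_a(x - s) = - q_a(s - x). *)
Lemma conv_qker_qker a b f s : 0 < a -> 0 < b -> L1 f ->
  \int[mu]_x (qker a (x - s) * convol (qker b) f x) = pi * convol (pker (a + b)) f s.
Proof.
move=> a0 b0 if1.
have [iG ->] := Rint_mul_conv (tame_qker b0) if1 (qker_L2 s a0).
rewrite -RintZ; last by apply: tame_section_L1 => //; apply: tame_pker; exact: addr_gt0.
apply: eq_Rint_ae; first exact: L1_measurable.
  apply: measurable_funM => //; apply: L1_measurable; apply: tame_section_L1 => //.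
  by apply: tame_pker; exact: addr_gt0.
apply: ae_imply (ae_neq s) => t /eqP ts.
rewrite (Rint_qker_qker b0 a0 ts) pkerC addrC; ring.
Qed.

Lemma conv_pker_qker a b f s : 0 < a -> 0 < b -> L1 f ->
  \int[mu]_x (pker a (x - s) * convol (qker b) f x) = pi * convol (qker (a + b)) f s.
Proof.
move=> a0 b0 if1.
have [iG ->] := Rint_mul_conv (tame_qker b0) if1 (pker_L2 s a0).
rewrite -RintZ; last by apply: tame_section_L1 => //; apply: tame_qker; exact: addr_gt0.
apply: eq_Rint_ae; first exact: L1_measurable.
  apply: measurable_funM => //; apply: L1_measurable; apply: tame_section_L1 => //.
  by apply: tame_qker; exact: addr_gt0.
apply: ae_imply (ae_neq s) => t /eqP ts; rewrite eq_sym in ts.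
rewrite (eq_Rint (g := fun x => pker a (x - s) * qker b (x - t))); last first.
  by move=> x; rewrite mulrC.
rewrite (Rint_pker_qker a0 b0 ts); ring.
Qed.

(** The function of [c] called phi in the introduction. *)
Definition poisson_form f c : R := \int[mu]_t (f t * convol (pker c) f t).

Lemma conv_qker_dot a b f : 0 < a -> 0 < b -> L1 f ->
  \int[mu]_x (convol (qker a) f x * convol (qker b) f x) = pi * poisson_form f (a + b).
Proof.
move=> a0 b0 if1.
have ab0 : 0 < a + b by exact: addr_gt0.
have lb := conv_L2 (tame_qker b0) if1.
rewrite (eq_Rint (g := fun x => convol (qker b) f x * convol (qker a) f x)); last first.
  by move=> x; rewrite mulrC.
have [iG ->] := Rint_mul_conv (tame_qker a0) if1 lb.
have E : (fun t => f t * \int[mu]_x (qker a (x - t) * convol (qker b) f x)) =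
   (fun t => pi * (f t * convol (pker (a + b)) f t)).
  by apply/funext => t; rewrite conv_qker_qker//; ring.
rewrite E RintZ//.
move: iG; rewrite E => iG.
apply: eq_integrable (L1Z pi^-1 iG) => // t _ /=.
by rewrite mulKf// gt_eqF// pi_gt0.
Qed.

(** The kernel is positive with integral pi, so 2 f(t) f(s) <= f(t)^2 + f(s)^2
    can be integrated against it. *)
Lemma poisson_form_le f c : 0 < c -> L1 f -> L2 f ->
  poisson_form f c <= pi * \int[mu]_t (f t ^+ 2).
Proof.
move=> c0 if1 l2f; have if2 := l2f.2; have mf := l2f.1.
have tP := tame_pker c0; have [mP [B PB] _ _] := tP.
pose F t s := pker c (t - s) * f s ^+ 2.
have [iF _ E] : [/\ L1 (fun t => \int[mu]_s F t s), L1 (fun s => \int[mu]_t F t s) &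
    \int[mu]_t \int[mu]_s F t s = \int[mu]_s \int[mu]_t F t s].
  apply: (@Rint_fubini _ F (fun s => pi * f s ^+ 2)).
  - apply: (measurable_kernel2 (f := fun s => f s ^+ 2)) => //; exact: measurable_funX.
  - move=> s; apply: eq_integrable (L1Z (f s ^+ 2) (pker_L1 s c0)) => // t _ /=.
    by rewrite mulrC.
  - move=> s; rewrite (eq_Rint (g := fun t => f s ^+ 2 * pker c (t - s))); last first.
      move=> t; rewrite /F ger0_norm 1?mulrC//.
      by rewrite mulr_ge0 ?sqr_ge0 ?pker_ge0.
    by rewrite (RintZ _ (pker_L1 s c0)) (Rint_pker s c0) mulrC.
  - exact: L1Z.
have EF : \int[mu]_s \int[mu]_t F t s = pi * \int[mu]_s (f s ^+ 2).
  rewrite -(RintZ _ if2); apply: eq_Rint => s.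
  rewrite (eq_Rint (g := fun t => f s ^+ 2 * pker c (t - s))); last by move=> t; rewrite mulrC.
  by rewrite (RintZ _ (pker_L1 s c0)) (Rint_pker s c0) mulrC.
have iP t : L1 (fun s => pker c (t - s)).
  by apply: eq_integrable (pker_L1 t c0) => // s _ /=; rewrite pkerC.
have pt t : f t * convol (pker c) f t <= 2^-1 * (pi * f t ^+ 2 + \int[mu]_s F t s).
  have i1 : L1 (fun s => pker c (t - s) * f s) by exact: tame_section_L1.
  have i2 : L1 (F t) by apply: tame_section_L1.
  have -> : pi * f t ^+ 2 = \int[mu]_s (f t ^+ 2 * pker c (t - s)).
    rewrite (RintZ _ (iP t)) mulrC; congr (_ * _).
    by rewrite -(Rint_pker t c0); apply: eq_Rint => s; rewrite pkerC.
  have i3 : L1 (fun s => f t ^+ 2 * pker c (t - s)) by exact: L1Z.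
  rewrite -(RintZ _ i1) -(RintD i3 i2) -(RintZ _ (L1D i3 i2)).
  apply: (Rint_le (L1Z _ i1) (L1Z _ (L1D i3 i2))).
  move=> s; rewrite /F; have p0 := pker_ge0 (t - s) c0.
  rewrite -subr_ge0 (_ : _ - _ = 2^-1 * (pker c (t - s) * (f t - f s) ^+ 2)); last by field.
  by apply: mulr_ge0; [rewrite invr_ge0|exact: mulr_ge0 p0 (sqr_ge0 _)].
have lc := conv_L2 tP if1.
have if3 := L1Z pi if2.
rewrite (le_trans (Rint_le (L2_mul l2f lc) (L1Z 2^-1 (L1D if3 iF)) pt))//.
rewrite (RintZ _ (L1D if3 iF)) (RintD if3 iF) E EF (RintZ _ if2).
by rewrite le_eqVlt; apply/orP; left; apply/eqP; field.
Qed.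

(** If phi increased from u to v, midpoint convexity would make it grow at
    least as fast along the whole arithmetic progression starting with u, v,
    against the upper bound. *)
Lemma midconvex_bounded_noninc (phi : R -> R) (M : R) :
  (forall a b, 0 < a -> 0 < b -> 2 * phi (a + b) <= phi (2 * a) + phi (2 * b)) ->
  (forall c, 0 < c -> phi c <= M) ->
  forall u v, 0 < u -> u <= v -> phi v <= phi u.
Proof.
move=> cvx bnd u v u0; rewrite le_eqVlt => /predU1P[->//|uv].
rewrite leNgt; apply/negP => puv.
pose x n := u + n%:R * (v - u); pose e := phi v - phi u.
have d0 : 0 < v - u by rewrite subr_gt0.
have e0 : 0 < e by rewrite subr_gt0.
have x0 n : 0 < x n by rewrite ltr_wpDr// mulr_ge0// ltW.
have step n : phi (x n.+1) - phi (x n) >= e.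
  elim: n => [|n IH].
    by rewrite /x mul1r mul0r addr0 /e [u + (v - u)]addrC subrK lexx.
  have h1 : 0 < 2^-1 * x n by rewrite mulr_gt0 ?invr_gt0.
  have h2 : 0 < 2^-1 * x n.+2 by rewrite mulr_gt0 ?invr_gt0.
  have := cvx _ _ h1 h2.
  have -> : 2^-1 * x n + 2^-1 * x n.+2 = x n.+1.
    by rewrite /x -!natr1; field.
  have -> : 2 * (2^-1 * x n) = x n by field.
  have -> : 2 * (2^-1 * x n.+2) = x n.+2 by field.
  by move: IH; lra.
have lb n : phi u + n%:R * e <= phi (x n).
  elim: n => [|n IH]; first by rewrite /x !mul0r !addr0.
  have := step n; rewrite -natr1 mulrDl mul1r; lra.
have [n hn] : exists n : nat, (M - phi u) / e < n%:R.
  by exists (Num.trunc ((M - phi u) / e)).+1; exact: truncnS_gt.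
have := le_trans (lb n) (bnd _ (x0 n)).
rewrite leNgt => /negP; apply.
by move: hn; rewrite ltr_pdivrMr// => ?; lra.
Qed.

(** The Cauchy property: see the introduction.  The heights [a n] are chosen so
    that phi(2 a_n) is within 4^-n of its supremum; by monotonicity this
    controls phi(a_j + a_k) as well, since a_j + a_k <= 2 max(a_j, a_k). *)
Lemma conv_qker_cvg f : L1 f -> L2 f -> exists (a : nat -> R) h,
  [/\ forall n, 0 < a n, a n @[n --> \oo] --> 0, L2 h &
      forall u, L2 u -> \int[mu]_x (u x * convol (qker (a n)) f x) @[n --> \oo]
                        --> \int[mu]_x (u x * h x)].
Proof.
move=> if1 l2f; have [phi phiE] : exists phi, phi = poisson_form f by exists (poisson_form f).
pose M := pi * \int[mu]_t (f t ^+ 2).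
have phiM c : 0 < c -> phi c <= M by move=> c0; rewrite phiE; exact: poisson_form_le.
have l2q a : 0 < a -> L2 (convol (qker a) f) by move=> a0; apply: conv_L2 => //; exact: tame_qker.
have dist a b : 0 < a -> 0 < b ->
    \int[mu]_x ((convol (qker a) f x - convol (qker b) f x) ^+ 2) =
    pi * (phi (2 * a) + phi (2 * b) - 2 * phi (a + b)).
  move=> a0 b0; have la := l2q _ a0; have lb := l2q _ b0.
  rewrite (eq_Rint (g := fun x => convol (qker a) f x * convol (qker a) f x
     + convol (qker b) f x * convol (qker b) f x
     - 2 * (convol (qker a) f x * convol (qker b) f x))); last by move=> x; ring.
  have laa := L2_mul la la; have lbb := L2_mul lb lb; have lab := L2_mul la lb.
  rewrite (RintB (L1D laa lbb) (L1Z 2 lab)) (RintD laa lbb) (RintZ 2 lab).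
  rewrite (conv_qker_dot a0 a0 if1) (conv_qker_dot b0 b0 if1) (conv_qker_dot a0 b0 if1).
  have -> : a + a = 2 * a by ring.
  have -> : b + b = 2 * b by ring.
  rewrite -phiE.
  move: (phi (2 * a)) (phi (2 * b)) (phi (a + b)) (pi : R) => A B C p; ring.
have noninc : forall u v, 0 < u -> u <= v -> phi v <= phi u.
  apply: (@midconvex_bounded_noninc phi M) => [a b a0 b0|c]; last exact: phiM.
  have : 0 <= pi * (phi (2 * a) + phi (2 * b) - 2 * phi (a + b)).
    by rewrite -dist//; apply: Rint_ge0 => x; exact: sqr_ge0.
  by rewrite pmulr_rge0 ?pi_gt0// subr_ge0.
pose S := [set phi c | c in [set c | 0 < c]].
have hS : has_sup S.
  split; first by exists (phi 1), 1 => //=.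
  by exists M => _ [c c0 <-]; exact: phiM.
have phiS c : 0 < c -> phi c <= sup S.
  by move=> c0; apply: ub_le_sup; [exact: hS.2|exists c].
have ex n : exists c, [/\ 0 < c, c <= (n.+1%:R)^-1 & sup S - (4^-1) ^+ n <= phi (2 * c)].
  have p0 : 0 < (4^-1) ^+ n :> R by rewrite exprn_gt0.
  have [_ [c c0 <-] hc] := sup_adherent p0 hS.
  exists (Num.min (c / 2) (n.+1%:R)^-1); split.
  - by rewrite lt_min divr_gt0//= invr_gt0.
  - by rewrite ge_min lexx orbT.
  - rewrite (le_trans (ltW hc))//; apply: noninc.
      by rewrite mulr_gt0// lt_min divr_gt0//= invr_gt0.
    rewrite (@le_trans _ _ (2 * (c / 2)))// ?ler_pM2l// ?ge_min ?lexx//.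
    by rewrite mulrC divfK.
have [a ha] := choice ex.
have a0 n : 0 < a n by case: (ha n).
exists a.
have [] := @L2_complete R (fun n => convol (qker (a n)) f) (pi * 2).
- by move=> n; exact: l2q.
- move=> k j kj; rewrite dist// -mulrA ler_pM2l ?pi_gt0//.
  have [_ _ hk] := ha k; have [_ _ hj] := ha j.
  have le4 : (4^-1) ^+ j <= (4^-1) ^+ k :> R.
    by rewrite ler_wiXn2l// invf_le1// ler1n.
  have low : sup S - (4^-1) ^+ k <= phi (a j + a k).
    have [jk|kj'] := leP (a j) (a k).
      rewrite (le_trans hk)//; apply: noninc; first by rewrite addr_gt0.
      by rewrite mulr2n mulrDl mul1r lerD2r.
    rewrite (@le_trans _ _ (phi (2 * a j)))//; first by lra.
    apply: noninc; first by rewrite addr_gt0.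
    by rewrite mulr2n mulrDl mul1r lerD2l ltW.
  have u1 := phiS (2 * a j) (mulr_gt0 (ltr0Sn R 1) (a0 j)).
  have u2 := phiS (2 * a k) (mulr_gt0 (ltr0Sn R 1) (a0 k)).
  lra.
move=> h l2h ch; exists h; split => //.
apply: (squeeze_cvgr _ (cvg_cst 0) (@cvg_harmonic R)).
by apply: nearW => n; have [? ? _] := ha n; rewrite ltW.
Qed.

Lemma cvg_conv_shift (K : R -> R -> R) (a : nat -> R) f y x :
  (forall c, 0 < c -> tame (K c)) -> 0 < y -> L1 f ->
  (forall n, 0 < a n) -> a n @[n --> \oo] --> 0 ->
  (forall c u, 0 < c -> `|K c u| <= c^-1) ->
  (forall u, {for y, continuous (K ^~ u)}) ->
  convol (K (y + a n)) f x @[n --> \oo] --> convol (K y) f x.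
Proof.
move=> tK y0 if1 a0 ca Kb cK.
have ya n : 0 < y + a n by rewrite addr_gt0.
have [] := @Rint_dct R (fun n t => K (y + a n) (x - t) * f t)
   (fun t => K y (x - t) * f t) (fun t => y^-1 * `|f t|).
- by move=> n; apply: L1_measurable; apply: tame_section_L1 => //; exact: tK.
- by apply: L1_measurable; apply: tame_section_L1 => //; exact: tK.
- by apply: L1Z; exact: L1_norm.
- move=> n t; rewrite normrM ler_wpM2r//.
  by rewrite (le_trans (Kb _ _ (ya n)))// lef_pV2 ?posrE// lerDl ltW.
- move=> t; apply: cvgM; last exact: cvg_cst.
  apply: (@continuous_cvg _ _ _ _ _ _ (K ^~ (x - t))); first exact: cK.
  have : y + a n @[n --> \oo] --> y + 0 by apply: cvgD => //; exact: cvg_cst.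
  by rewrite addr0.
by [].
Qed.

Lemma continuous_den_param u y : 0 < y -> {for y, continuous (fun c : R => (u ^+ 2 + c ^+ 2)^-1)}.
Proof.
move=> y0; apply: cvgV; first by rewrite gt_eqF// den_gt0.
by apply: cvgD; [exact: cvg_cst|exact: exprn_continuous].
Qed.

(** Testing the weak limit of q_(a_n) * f against translates of p_y and q_y and
    applying the semigroup identities leaves q_(y + a_n) * f and p_(y + a_n) * f,
    which converge as a_n tends to 0. *)
Lemma hilbert_L2_limit f : L1 f -> L2 f -> exists h,
  [/\ L2 h, forall y x, 0 < y -> convol (pker y) h x = pi * convol (qker y) f x &
      forall y x, 0 < y -> convol (qker y) h x = - (pi * convol (pker y) f x)].
Proof.
move=> if1 l2f; have [a [h [a0 ca l2h ch]]] := conv_qker_cvg if1 l2f.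
exists h; split => // y x y0.
- have := ch _ (pker_L2 x y0).
  under eq_fun do rewrite (conv_pker_qker _ y0 (a0 _) if1).
  have -> : \int[mu]_t (pker y (t - x) * h t) = convol (pker y) h x.
    by apply: eq_Rint => t; rewrite pkerC.
  move=> c1.
  have c2 : pi * convol (qker (y + a n)) f x @[n --> \oo] --> pi * convol (qker y) f x.
    apply: cvgM; first exact: cvg_cst.
    apply: (cvg_conv_shift (K := qker)) => //.
    + exact: tame_qker.
    + by move=> c u c0; exact: qker_le.
    + by move=> u; apply: cvgM; [exact: cvg_cst|exact: continuous_den_param].
  by rewrite -(cvg_lim (@Rhausdorff R) c1) (cvg_lim (@Rhausdorff R) c2).
- have := ch _ (qker_L2 x y0).
  under eq_fun do rewrite (conv_qker_qker _ y0 (a0 _) if1).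
  have -> : \int[mu]_t (qker y (t - x) * h t) = - convol (qker y) h x.
    transitivity (-1 * convol (qker y) h x); last by rewrite mulN1r.
    rewrite /convol -RintZ.
      by apply: eq_Rint => t; rewrite qkerC mulN1r mulNr.
    apply: L2_mul => //; apply: L2_le (qker_L2 x y0) _.
      by apply: measurable_section; case: (tame_qker y0).
    by move=> t; rewrite qkerC normrN.
  move=> c1.
  have c2 : pi * convol (pker (y + a n)) f x @[n --> \oo] --> pi * convol (pker y) f x.
    apply: cvgM; first exact: cvg_cst.
    apply: (cvg_conv_shift (K := pker)) => //.
    + exact: tame_pker.
    + by move=> c u c0; rewrite ger0_norm ?pker_le ?pker_ge0.
    + by move=> u; apply: cvgM; [exact: cvg_id|exact: continuous_den_param].
  rewrite -[LHS]opprK -(cvg_lim (@Rhausdorff R) c1) (cvg_lim (@Rhausdorff R) c2).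
  by [].
Qed.

End Convolution.

(** * Poisson integrals at Lebesgue points *)

Section LebesguePoints.
Context {R : realType}.
Local Notation mu := (@lebesgue_measure R).
Implicit Types (f g h : R -> R) (a b c s t x e r : R).

Lemma L2_locally_integrable f : L2 f -> locally_integrable setT f.
Proof.
move=> [mf if2]; split => //; first exact: openT.
move=> K _ cK.
have mK : measurable K by exact: compact_measurable.
have i1 : mu.-integrable K (EFin \o cst (1 : R)).
  by apply: measurable_bounded_integrable => //; [exact: compact_finite_measure|
    exists 1; split => // M M1 x _ /=; rewrite normr1 ltW].
have i2 : mu.-integrable K (EFin \o (fun x => f x ^+ 2)).
  by apply: integrableS if2.
have : mu.-integrable K (EFin \o f).
  have mfK : measurable_fun K (EFin \o f).
    by apply/measurable_EFinP; exact: (measurable_funS measurableT _ mf).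
  have i3 := @integrableD _ _ R mu K mK _ _ i1 i2.
  apply: (@le_integrable _ _ R mu K mK (EFin \o f) _ mfK _ i3).
  move=> x _ /=; rewrite lee_fin [leRHS]ger0_norm; last first.
    by rewrite addr_ge0// sqr_ge0.
  have := sqr_ge0 (`|f x| - 1); rewrite sqrrB1 real_normK ?num_real//.
  by have := sqr_ge0 (f x); have := normr_ge0 (f x); lra.
by move=> /integrableP[].
Qed.

Lemma L2_ae_lebesgue_pt f : L2 f -> {ae mu, forall x, lebesgue_pt f x}.
Proof. by move=> /L2_locally_integrable; exact: lebesgue_differentiation. Qed.

Definition osc f x t : R := `|f t - f x|.

Lemma osc_ge0 f x t : 0 <= osc f x t. Proof. exact: normr_ge0. Qed.

Lemma measurable_osc f x : measurable_fun setT f -> measurable_fun setT (osc f x).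
Proof. by move=> mf; apply: measurableT_comp => //; exact: measurable_funB. Qed.

Lemma pker_osc_L1 e f x : 0 < e -> L2 f -> L1 (fun t => pker e (x - t) * osc f x t).
Proof.
move=> e0 l2f.
have l2p : L2 (fun t => pker e (x - t)).
  by rewrite (_ : (fun t => _) = (fun t => pker e (t - x)));
    [exact: pker_L2|apply/funext => t; rewrite pkerC].
have l1p : L1 (fun t => pker e (x - t)).
  by rewrite (_ : (fun t => _) = (fun t => pker e (t - x)));
    [exact: pker_L1|apply/funext => t; rewrite pkerC].
apply: L1_le (L1D (L1_norm (L2_mul l2p l2f)) (L1Z `|f x| l1p)) _.
  apply: measurable_funM; first exact: L1_measurable.
  exact: measurable_osc l2f.1.
move=> t; have p0 := pker_ge0 (x - t) e0.
rewrite normrM [X in _ <= X + _]normrM (ger0_norm p0) (ger0_norm (osc_ge0 f x t)) [X in _ <= _ + X]mulrC -mulrDr.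
by apply: ler_wpM2l => //; exact: ler_normB.
Qed.

(** On the ball of radius r the kernel p_r is at least 1 / (2 r), so the
    integrability of p_r times the oscillation suffices. *)
Lemma osc_ball_L1 f x r : 0 < r -> L2 f -> L1 (osc f x \_ (ball x r)).
Proof.
move=> r0 l2f.
apply: L1_le (L1Z (2 * r) (pker_osc_L1 x r0 l2f)) _.
  by apply: measurable_fun_patch; [exact: measurable_ball|exact: measurable_osc l2f.1].
move=> t; rewrite /patch; case: ifPn => [|_]; last first.
  rewrite normr0; apply: mulr_ge0; first by rewrite mulr_ge0// ltW.
  exact: mulr_ge0 (pker_ge0 _ r0) (osc_ge0 _ _ _).
rewrite inE /ball /= => tr.
rewrite (ger0_norm (osc_ge0 _ _ _)) mulrA ler_peMl ?osc_ge0//.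
rewrite /pker mulrA ler_pdivlMr ?den_gt0// mul1r.
have : (x - t) ^+ 2 <= r ^+ 2.
  rewrite -(real_normK (num_real (x - t))) lerXn2r ?nnegrE//; first exact: ltW.
  exact: ltW tr.
by rewrite !expr2 => ?; lra.
Qed.

(** Turns the vanishing of the extended real averages into a real bound on every
    small ball, in the form consumed by the dyadic summation. *)
Lemma lebesgue_pt_osc f x : L2 f -> lebesgue_pt f x -> forall eta : R, 0 < eta ->
  exists2 d : R, 0 < d & forall r, 0 < r -> r <= d ->
    \int[mu]_t (osc f x \_ (ball x r)) t <= eta * (2 * r).
Proof.
move=> l2f lf eta eta0.
have /fine_cvgP[fin] := lf.
move=> /cvgrPdist_lt/(_ _ eta0) near1.
have : \forall r \near 0^'+, \int[mu]_t (osc f x \_ (ball x r)) t <= eta * (2 * r).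
  near=> r.
  have r0 : 0 < r by [].
  have : `|0 - fine (davg f x r)| < eta by near: r; exact: near1.
  rewrite sub0r normrN => /(le_lt_trans (ler_norm _)).
  rewrite /davg /iavg (lebesgue_measure_ball _ (ltW r0)).
  have -> : (\int[mu]_(y in ball x r) `|((center (f x) \o f) y)%:E|)%E =
      (\int[mu]_t (osc f x \_ (ball x r)) t)%:E.
    rewrite EFin_Rint; last exact: osc_ball_L1.
    by rewrite integral_mkcond; apply: eq_integral => y _ /=; rewrite /patch; case: ifP.
  rewrite inver mulrn_eq0/= gt_eqF//= mulrC ltr_pdivrMr ?pmulrn_rgt0//.
  by rewrite mulr_natl; exact: ltW.
case=> d /= d0 hd; exists (d / 2); first by rewrite divr_gt0.
move=> r r0 rd; apply: hd => //=; rewrite sub0r normrN gtr0_norm//.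
by rewrite (le_lt_trans rd)// ltr_pdivrMr// ltr_pMr// ltr1n.
Unshelve. all: end_near. Qed.

(** On the annulus between the radii 2^n e and 2^(n+1) e the kernel p_e is at most
    1 / (4^n e), while the oscillation integrates to at most 4 eta 2^n e: the
    annulus contributes 4 eta / 2^n, which is 8 eta / 2^n - 8 eta / 2^(n+1). *)
Lemma osc_dyadic f x e eta d n : L2 f -> 0 < e -> 0 <= eta ->
  (forall r, 0 < r -> r <= d -> \int[mu]_t (osc f x \_ (ball x r)) t <= eta * (2 * r)) ->
  2 ^+ n * e <= d ->
  \int[mu]_t ((fun t => pker e (x - t) * osc f x t) \_ (ball x (2 ^+ n * e))) t
    <= eta * (10 - 8 / 2 ^+ n).
Proof.
move=> l2f e0 eta0 hd; have ip := pker_osc_L1 x e0 l2f.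
have ipb r : L1 ((fun t => pker e (x - t) * osc f x t) \_ (ball x r)).
  apply: (L1_le _ ip).
    by apply: measurable_fun_patch; [exact: measurable_ball|exact: L1_measurable ip].
  move=> t; have p0 : 0 <= pker e (x - t) * osc f x t.
    exact: mulr_ge0 (pker_ge0 _ e0) (osc_ge0 _ _ _).
  by rewrite /patch; case: ifP => _; [rewrite (ger0_norm p0)|rewrite normr0].
elim: n => [|n IH].
  rewrite expr0 mul1r => ed.
  have io := osc_ball_L1 x e0 l2f.
  apply: (@le_trans _ _ (e^-1 * (eta * (2 * e)))); last first.
    by rewrite le_eqVlt; apply/orP; left; apply/eqP; field; rewrite gt_eqF.
  apply: (@le_trans _ _ (\int[mu]_t (e^-1 * (osc f x \_ (ball x e)) t))).
    apply: (Rint_le (ipb _) (L1Z _ io)) => t.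
    rewrite /patch; case: ifP => _; last by rewrite mulr0.
    by apply: ler_wpM2r; [exact: osc_ge0|exact: pker_le].
  by rewrite (RintZ _ io) ler_pM2l ?invr_gt0// hd.
move=> hn.
have p0 : 0 < 2 ^+ n :> R by rewrite exprn_gt0.
have p1 : 0 < 2 ^+ n.+1 :> R by rewrite exprn_gt0.
have {}IH := IH (le_trans _ hn).
have io := osc_ball_L1 x (mulr_gt0 p1 e0) l2f.
have i2 := L1Z (4 ^+ n * e)^-1 io.
apply: (@le_trans _ _ (\int[mu]_t
   (((fun t => pker e (x - t) * osc f x t) \_ (ball x (2 ^+ n * e))) t
   + (4 ^+ n * e)^-1 * (osc f x \_ (ball x (2 ^+ n.+1 * e))) t))).
  apply: (Rint_le (ipb _) (L1D (ipb _) i2)) => t.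
  have o0 := osc_ge0 f x t.
  have pp : 0 <= pker e (x - t) * osc f x t by exact: mulr_ge0 (pker_ge0 _ e0) o0.
  have c0 : 0 <= (4 ^+ n * e)^-1 by rewrite invr_ge0 mulr_ge0 ?exprn_ge0// ltW.
  rewrite /patch; case: ifPn => [_|_]; case: ifPn => [_|nb].
  - by rewrite lerDl mulr_ge0.
  - rewrite add0r; apply: ler_wpM2r => //.
    move: nb; rewrite notin_setE /ball /= => /negP; rewrite -leNgt => nb.
    rewrite /pker ler_pdivrMr ?den_gt0// ler_pdivlMl ?mulr_gt0 ?exprn_gt0//.
    have : (2 ^+ n * e) ^+ 2 <= (x - t) ^+ 2.
      rewrite -(real_normK (num_real (x - t))) lerXn2r ?nnegrE// mulr_ge0// ltW//.
    rewrite exprMn -exprM mulnC exprM (_ : 2 ^+ 2 = 4 :> R); last by ring.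
    have := sqr_ge0 e; rewrite [e ^+ 2]expr2; lra.
  - by rewrite mulr0 addr0.
  - by rewrite mulr0 addr0.
rewrite (RintD (ipb _) i2) (RintZ _ io).
apply: (@le_trans _ _ (eta * (10 - 8 / 2 ^+ n)
   + (4 ^+ n * e)^-1 * (eta * (2 * (2 ^+ n.+1 * e))))).
  apply: lerD.
    by apply: IH; rewrite ler_pM2r// ler_eXn2l// ltr1n.
  by rewrite ler_pM2l ?invr_gt0 ?mulr_gt0 ?exprn_gt0// hd// mulr_gt0.
rewrite le_eqVlt; apply/orP; left; apply/eqP.
rewrite (_ : 4 ^+ n = 2 ^+ n * 2 ^+ n :> R); last by rewrite -exprMn; congr (_ ^+ _); ring.
by rewrite exprS; field; rewrite !gt_eqF.
Qed.

Lemma dyadic_scale e d : 0 < e -> e <= d -> exists n, 2 ^+ n * e <= d /\ d < 2 ^+ n.+1 * e.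
Proof.
move=> e0 ed.
have ex : exists n, d < 2 ^+ n * e.
  exists (Num.trunc (d / e)).+1; rewrite -ltr_pdivrMr//.
  rewrite (lt_le_trans (truncnS_gt _))// -natrX ler_nat.
  exact: (ltnW (ltn_expl _ _)).
case: (ex_minnP ex) => -[|m] hm minm.
  by move: hm; rewrite expr0 mul1r ltNge ed.
exists m; split => //; rewrite leNgt; apply/negP => /minm.
by rewrite ltnn.
Qed.

(** Dyadic annuli up to the radius [d] are controlled by the Lebesgue point
    property.  Farther away, p_e is at most e (1 + 4 / d^2) p_1, and the
    oscillation is integrable against p_1. *)
Lemma pker_osc_cvg0 f x : L2 f -> lebesgue_pt f x ->
  \int[mu]_t (pker e (x - t) * osc f x t) @[e --> 0^'+] --> 0.
Proof.
move=> l2f lf; apply/cvgrPdist_le => eps eps0.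
have eta0 : 0 < eps / 20 by rewrite divr_gt0.
have [d d0 hd] := lebesgue_pt_osc l2f lf eta0.
have i1 := pker_osc_L1 x ltr01 l2f.
set K := \int[mu]_t (pker 1 (x - t) * osc f x t) in i1.
have K0 : 0 <= K by apply: Rint_ge0 => t; exact: mulr_ge0 (pker_ge0 _ ltr01) (osc_ge0 _ _ _).
(* The largest dyadic radius below [d] exceeds d / 2; beyond it
   (x - t)^2 >= d^2 / 4 and p_e <= e C p_1. *)
pose C := 1 + 4 / d ^+ 2.
have C0 : 0 < C by rewrite addr_gt0// divr_gt0// exprn_gt0.
have CK0 : 0 < C * K + 1 by rewrite ltr_wpDl// mulr_ge0// ltW.
near=> e.
have e0 : 0 < e by [].
have ed : e <= d by near: e; exact: nbhs_right_le.
have eK : e <= (eps / 2) / (C * K + 1).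
  by near: e; apply: nbhs_right_le; rewrite !divr_gt0.
have ie := pker_osc_L1 x e0 l2f.
rewrite sub0r normrN ger0_norm; last first.
  by apply: Rint_ge0 => t; exact: mulr_ge0 (pker_ge0 _ e0) (osc_ge0 _ _ _).
have [n [n1 n2]] := dyadic_scale e0 ed.
have ib : L1 ((fun t => pker e (x - t) * osc f x t) \_ (ball x (2 ^+ n * e))).
  apply: (L1_le _ ie).
    by apply: measurable_fun_patch; [exact: measurable_ball|exact: L1_measurable ie].
  move=> t; have p0 : 0 <= pker e (x - t) * osc f x t.
    exact: mulr_ge0 (pker_ge0 _ e0) (osc_ge0 _ _ _).
  by rewrite /patch; case: ifP => _; [rewrite (ger0_norm p0)|rewrite normr0].
apply: (@le_trans _ _ (eps / 20 * (10 - 8 / 2 ^+ n) + (e * C) * K)); last first.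
  have h1 : eps / 20 * (10 - 8 / 2 ^+ n) <= eps / 2.
    have : 0 <= 8 / 2 ^+ n :> R by rewrite divr_ge0// exprn_ge0.
    move: (8 / 2 ^+ n) => q q0; nra.
  have h2 : e * (C * K + 1) <= eps / 2 by rewrite -ler_pdivlMr.
  have : e * C * K <= eps / 2 by move: h2; rewrite mulrDr mulrA; lra.
  by move=> ?; lra.
apply: le_trans (_ : _ <= \int[mu]_t
   (((fun t => pker e (x - t) * osc f x t) \_ (ball x (2 ^+ n * e))) t
    + (e * C) * (pker 1 (x - t) * osc f x t))) _.
  apply: (Rint_le ie (L1D ib (L1Z _ i1))) => t.
  have o0 := osc_ge0 f x t.
  rewrite /patch; case: ifPn => [_|nb].
    rewrite lerDl; apply: mulr_ge0; first exact: mulr_ge0 (ltW e0) (ltW C0).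
    exact: mulr_ge0 (pker_ge0 _ ltr01) o0.
  rewrite add0r mulrA; apply: ler_wpM2r => //.
  move: nb; rewrite notin_setE /ball /= => /negP; rewrite -leNgt => nb.
  have {nb} : (d / 2) ^+ 2 <= (x - t) ^+ 2.
    rewrite -(real_normK (num_real (x - t))) lerXn2r ?nnegrE//.
      by rewrite divr_ge0// ltW.
    by rewrite (le_trans _ nb)// ler_pdivrMr// mulrC mulrA -exprS ltW.
  move: (x - t) => u ud.
  rewrite /pker expr1n ler_pdivrMr ?den_gt0// mulrA mulr1 mulrAC ler_pdivlMr; last first.
    by rewrite ltr_wpDl// sqr_ge0.
  rewrite -!mulrA ler_pM2l//.
  have d20 : 0 < d ^+ 2 by rewrite exprn_gt0.
  have : 1 <= 4 / d ^+ 2 * u ^+ 2.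
    rewrite mulrAC ler_pdivlMr// mul1r.
    by move: ud; rewrite expr_div_n (_ : 2 ^+ 2 = 4 :> R); [lra|ring].
  rewrite /C mulrDl mul1r mulrDr.
  have q0 : 0 <= 4 / d ^+ 2 by rewrite divr_ge0// ltW.
  have := mulr_ge0 q0 (sqr_ge0 e); have := sqr_ge0 e.
  lra.
rewrite (RintD ib (L1Z _ i1)) (RintZ _ i1) lerD2r.
exact: (osc_dyadic l2f e0 (ltW eta0) hd n1).
Unshelve. all: end_near. Qed.

Lemma poisson_lebesgue_pt f x : L2 f -> lebesgue_pt f x ->
  convol (pker e) f x @[e --> (0 : R)^'+] --> pi * f x.
Proof.
move=> l2f lf; apply/cvgrPdist_le => eps eps0.
have /cvgrPdist_le/(_ _ eps0) h := pker_osc_cvg0 l2f lf.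
near=> e; have e0 : 0 < e by [].
apply: (@le_trans _ _ (\int[mu]_t (pker e (x - t) * osc f x t))); last first.
  have : `|0 - \int[mu]_t (pker e (x - t) * osc f x t)| <= eps by near: e; exact: h.
  by rewrite sub0r normrN; apply: le_trans; exact: ler_norm.
have l2p : L2 (fun t => pker e (x - t)).
  by rewrite (_ : (fun t => _) = (fun t => pker e (t - x)));
    [exact: pker_L2|apply/funext => t; rewrite pkerC].
have l1p : L1 (fun t => pker e (x - t)).
  by rewrite (_ : (fun t => _) = (fun t => pker e (t - x)));
    [exact: pker_L1|apply/funext => t; rewrite pkerC].
have pE : \int[mu]_t pker e (x - t) = pi.
  by rewrite -(Rint_pker x e0); apply: eq_Rint => t; rewrite pkerC.
have lpf := L2_mul l2p l2f.
have -> : pi * f x - convol (pker e) f x = \int[mu]_t (f x * pker e (x - t) - pker e (x - t) * f t).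
  by rewrite (RintB (L1Z _ l1p) lpf) (RintZ _ l1p) pE mulrC.
rewrite (le_trans (Rint_norm (L1B (L1Z _ l1p) lpf)))// le_eqVlt; apply/orP; left; apply/eqP.
apply: eq_Rint => t; rewrite mulrC -mulrBr normrM (ger0_norm (pker_ge0 _ e0)).
by rewrite distrC.
Unshelve. all: end_near. Qed.

End LebesguePoints.

(** * The principal value integral *)

Section PrincipalValue.
Context {R : realType}.
Local Notation mu := (@lebesgue_measure R).
Implicit Types (f g h : R -> R) (a b c s t x e r u : R).

Lemma lebesgue_measure_reflect c (A : set (measurableTypeR R)) : measurable A ->
  pushforward mu (fun t : measurableTypeR R => c - t : measurableTypeR R) A = mu A.
Proof.
move=> mA; apply/esym/lebesgue_measure_unique => //=.
  exact: measurable_funB.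
move=> _ _ [[a b]] _ <-.
rewrite /pushforward.
have -> : (fun t : R => c - t) @^-1` `]a, b] = `[c - b, c - a[%classic.
  by apply/seteqP; split => x /=; rewrite !in_itv /= => /andP[h1 h2]; apply/andP;
    split; lra.
rewrite !lebesgue_measure_itv/= !lte_fin ltrD2l ltrN2.
by case: ifP => // _; rewrite -!EFinD; congr EFin; ring.
Qed.

Lemma measurable_reflect c f : measurable_fun setT f ->
  measurable_fun setT (fun t => f (c - t)).
Proof. by move=> mf; apply: (measurableT_comp mf); exact: measurable_funB. Qed.

Lemma Rint_reflect c f : measurable_fun setT f -> L1 (fun t => f (c - t)) ->
  \int[mu]_t f (c - t) = \int[mu]_t f t.
Proof.
move=> mf ifc; rewrite /Rintegral; congr fine.
have mphi : measurable_fun setT (fun t : measurableTypeR R => c - t : measurableTypeR R).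
  exact: measurable_funB.
have mfE : measurable_fun setT (EFin \o f) by exact/measurable_EFinP.
have := @integral_pushforward _ _ (measurableTypeR R) (measurableTypeR R) R _ mphi mu
  setT (EFin \o f) mfE ifc measurableT.
move=> <-; apply: eq_measure_integral => A mA _.
exact: lebesgue_measure_reflect.
Qed.

(** Invariance of the Lebesgue measure under the reflection about [x]. *)
Lemma Rint_odd x f : L1 f -> (forall t, f (2 * x - t) = - f t) -> \int[mu]_t f t = 0.
Proof.
move=> if1 fo.
have E : (fun t => f (2 * x - t)) = (fun t => -1 * f t).
  by apply/funext => t; rewrite fo mulN1r.
have := @Rint_reflect (2 * x) f (L1_measurable if1).
rewrite E (RintZ _ if1) => /(_ (L1Z _ if1)).
by move=> h; lra.
Qed.

(** The inverse is the pointwise limit of the continuous functions q_(1/n),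
    also at 0, where the convention 0^-1 = 0 matches. *)
Lemma measurable_inv : measurable_fun setT (fun u : R => u^-1).
Proof.
apply: (measurable_fun_cvg (h := fun n u => qker (n.+1%:R)^-1 u)).
  by move=> n; case: (@tame_qker R (n.+1%:R)^-1); rewrite ?invr_gt0.
move=> u _; have [->|u0] := eqVneq u 0.
  by rewrite invr0; apply: cvg_near_cst; apply: nearW => n; rewrite /qker mul0r.
have -> : u^-1 = u / (u ^+ 2 + 0 * 0) by rewrite mul0r addr0; field.
apply: cvgM; first exact: cvg_cst.
apply: cvgV; first by rewrite mul0r addr0 sqrf_eq0.
apply: cvgD; first exact: cvg_cst.
by apply: cvgM; exact: cvg_harmonic.
Qed.

(** The kernel of the principal value integral, truncated at distance [e]. *)
Definition hker e u : R := if e < `|u| then u^-1 else 0.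

Lemma measurable_hker e : measurable_fun setT (hker e).
Proof.
apply: measurable_fun_if => //.
- by apply: measurable_fun_ltr => //; exact: measurableT_comp.
- by apply: (measurable_funS measurableT) => //; exact: measurable_inv.
Qed.

(** Outside of ]-e, e[ the difference 1/u - q_e(u) equals (e/u) p_e(u); inside it
    is - q_e(u), which is (u/e) p_e(u) up to sign. *)
Lemma hker_qker_le e u : 0 < e -> `|hker e u - qker e u| <= pker e u.
Proof.
move=> e0; have d0 := den_gt0 u e0.
rewrite /hker; case: ltP => [eu|ue].
  have u0 : u != 0 by rewrite -normr_gt0 (lt_trans e0).
  have -> : u^-1 - qker e u = (e / u) * pker e u.
    by rewrite /qker /pker; field; rewrite u0 gt_eqF.
  rewrite normrM (ger0_norm (pker_ge0 _ e0)) ler_piMl ?pker_ge0//.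
  by rewrite normrM normfV (gtr0_norm e0) ler_pdivrMr ?normr_gt0// mul1r ltW.
rewrite sub0r normrN /qker normrM normfV (gtr0_norm d0) /pker ler_pM2r ?invr_gt0//.
Qed.

Lemma hkerN e u : hker e (- u) = - hker e u.
Proof. by rewrite /hker normrN; case: ifP => _; rewrite ?invrN ?oppr0. Qed.

Lemma truncated_integralE e g x :
  \int[mu]_(t in [set t | e < `|x - t|]) (g t / (x - t)) =
  \int[mu]_t (hker e (x - t) * g t).
Proof.
rewrite Rintegral_mkcond; apply: eq_Rint => t.
rewrite /patch /hker; case: ifPn; rewrite ?inE ?notin_setE /=.
  by move=> ->; rewrite mulrC.
by move=> /negP/negbTE ->; rewrite mul0r.
Qed.

(** The kernel hker - qker is odd, so it does not see constants and [g t] can be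
    replaced by [g t - g x]. *)
Lemma truncated_sub_qker e g x : 0 < e -> L1 g -> L2 g ->
  `|\int[mu]_t (hker e (x - t) * g t) - convol (qker e) g x| <=
  \int[mu]_t (pker e (x - t) * osc g x t).
Proof.
move=> e0 ig1 l2g; pose k u := hker e u - qker e u.
have mk : measurable_fun setT k.
  by apply: measurable_funB; [exact: measurable_hker|case: (tame_qker e0)].
have l1p : L1 (fun t => pker e (x - t)).
  by rewrite (_ : (fun t => _) = (fun t => pker e (t - x)));
    [exact: pker_L1|apply/funext => t; rewrite pkerC].
have ik : L1 (fun t => k (x - t)).
  by apply: (L1_le _ l1p) => [|t]; [exact: measurable_reflect|exact: hker_qker_le].
have k0 : \int[mu]_t k (x - t) = 0.
  apply: (@Rint_odd x _ ik) => t.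
  by rewrite (_ : x - (2 * x - t) = - (x - t)); [rewrite /k hkerN qkerN opprD|ring].
have kb u : `|k u| <= e^-1.
  by rewrite (le_trans (hker_qker_le _ e0))// pker_le.
have ikg : L1 (fun t => k (x - t) * g t).
  by apply: (@L1_bounded_mul R _ _ e^-1) => //; exact: measurable_reflect.
have iq : L1 (fun t => qker e (x - t) * g t) by apply: tame_section_L1 => //; exact: tame_qker.
have ih : L1 (fun t => hker e (x - t) * g t).
  rewrite (_ : (fun t => _) = (fun t => k (x - t) * g t + qker e (x - t) * g t)).
    exact: L1D ikg iq.
  by apply/funext => t; rewrite /k; ring.
rewrite /convol -(RintB ih iq).
have ikx := L1Z (g x) ik.
have -> : \int[mu]_t (hker e (x - t) * g t - qker e (x - t) * g t) =
   \int[mu]_t (k (x - t) * g t - g x * k (x - t)).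
  rewrite (RintB ikg ikx) (RintZ _ ik) k0 mulr0 subr0.
  by apply: eq_Rint => t; rewrite /k; ring.
rewrite (le_trans (Rint_norm (L1B ikg ikx)))//.
apply: (Rint_le (L1_norm (L1B ikg ikx)) (pker_osc_L1 x e0 l2g)) => t.
rewrite [g x * _]mulrC -mulrBr normrM; apply: ler_wpM2r; first exact: normr_ge0.
exact: hker_qker_le.
Qed.

(** At a common Lebesgue point of [g] and [h] both q_e * g, which is p_e * h / pi,
    and the truncated integrals converge to [h x]. *)
Lemma hilbertR_ae_eq g h : L1 g -> L2 g -> L2 h ->
  (forall y x, 0 < y -> convol (pker y) h x = pi * convol (qker y) g x) ->
  {ae mu, forall x, hilbertR g x = pi^-1 * h x}.
Proof.
move=> ig1 l2g l2h E.
apply: ae_imply (ae_and (L2_ae_lebesgue_pt l2g) (L2_ae_lebesgue_pt l2h)) => x [lg lh].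
rewrite /hilbertR; apply: cvg_lim; first exact: Rhausdorff.
apply: cvgM; first exact: cvg_cst.
have pi0 : (pi : R) != 0 by rewrite gt_eqF// pi_gt0.
have c1 : convol (qker e) g x @[e --> (0 : R)^'+] --> h x.
  have := poisson_lebesgue_pt l2h lh => c0.
  have {}c0 : pi^-1 * convol (pker e) h x @[e --> (0 : R)^'+] --> h x.
    have -> : h x = pi^-1 * (pi * h x) by rewrite mulKf.
    by apply: cvgM => //; exact: cvg_cst.
  apply: cvg_trans c0; apply: near_eq_cvg; near=> e.
  by rewrite E// mulKf.
have c2 := pker_osc_cvg0 l2g lg.
apply/cvgrPdist_le => eps eps0.
have eps2 : 0 < eps / 2 by rewrite divr_gt0.
have /cvgrPdist_le/(_ _ eps2) n1 := c1.
have /cvgrPdist_le/(_ _ eps2) n2 := c2.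
near=> e.
have e0 : 0 < e by [].
have h1 : `|h x - convol (qker e) g x| <= eps / 2 by near: e; exact: n1.
have h2 : `|0 - \int[mu]_t (pker e (x - t) * osc g x t)| <= eps / 2 by near: e; exact: n2.
have {}h2 : \int[mu]_t (pker e (x - t) * osc g x t) <= eps / 2.
  by move: h2; rewrite sub0r normrN; apply: le_trans; exact: ler_norm.
have h3 := truncated_sub_qker x e0 ig1 l2g.
rewrite truncated_integralE (splitr eps).
rewrite (_ : h x - _ = (h x - convol (qker e) g x)
  - (\int[mu]_t (hker e (x - t) * g t) - convol (qker e) g x)); last by ring.
rewrite (le_trans (ler_normB _ _))// lerD//.
exact: le_trans h3 h2.
Unshelve. all: end_near. Qed.

End PrincipalValue.

(** * Moments of a conjugate pair *)

Section Moments.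
Context {R : realType}.
Local Notation mu := (@lebesgue_measure R).
Implicit Types (f g h : R -> R) (t x y : R) (n N : nat).

Lemma cvg_pker_scaled t : n.+1%:R * pker n.+1%:R t @[n --> \oo] --> (1 : R).
Proof.
have E y : 0 < y -> y * pker y t = (1 + t ^+ 2 * (y^-1 * y^-1))^-1.
  move=> y0; rewrite /pker; have d0 := den_gt0 t y0; field.
  by rewrite (gt_eqF y0) gt_eqF//= -expr2 addrC.
under eq_fun do rewrite E//.
suff : (1 + t ^+ 2 * ((n.+1%:R)^-1 * (n.+1%:R)^-1))^-1 @[n --> \oo]
   --> (1 + t ^+ 2 * (0 * 0) : R)^-1 by rewrite !mulr0 addr0 invr1.
apply: cvgV; first by rewrite !mulr0 addr0 oner_neq0.
apply: cvgD; first exact: cvg_cst.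
by apply: cvgM; [exact: cvg_cst|apply: cvgM; exact: cvg_harmonic].
Qed.

Lemma cvg_qker_scaled t : n.+1%:R * qker n.+1%:R t @[n --> \oo] --> (0 : R).
Proof.
have E y : 0 < y -> y * qker y t = (y * pker y t) * (t * y^-1).
  by move=> y0; rewrite /qker /pker; have d0 := den_gt0 t y0; field; rewrite !gt_eqF.
under eq_fun do rewrite E//.
suff : (n.+1%:R * pker n.+1%:R t) * (t * (n.+1%:R)^-1) @[n --> \oo]
   --> (1 * (t * 0) : R) by rewrite !mulr0.
apply: cvgM; first exact: cvg_pker_scaled.
by apply: cvgM; [exact: cvg_cst|exact: cvg_harmonic].
Qed.

Lemma pker_mul_L1 y f : 0 < y -> L1 f -> L1 (fun t => pker y t * f t).
Proof.
move=> y0; have [mK [B KB] _ _] := tame_pker y0.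
exact: L1_bounded_mul mK KB.
Qed.

Lemma qker_mul_L1 y f : 0 < y -> L1 f -> L1 (fun t => qker y t * f t).
Proof.
move=> y0; have [mK [B KB] _ _] := tame_qker y0.
exact: L1_bounded_mul mK KB.
Qed.

(** High above the origin y p_y is close to 1: y times the Poisson integral at 0
    recovers the total mass. *)
Lemma cvg_Rint_pker f : L1 f ->
  n.+1%:R * \int[mu]_t (pker n.+1%:R t * f t) @[n --> \oo] --> \int[mu]_t f t.
Proof.
move=> if1.
have n0 n : 0 < n.+1%:R :> R by [].
have [] := @Rint_dct R (fun n t => n.+1%:R * (pker n.+1%:R t * f t)) f (fun t => `|f t|).
- by move=> n; exact: L1_measurable (L1Z _ (pker_mul_L1 (n0 n) if1)).
- exact: L1_measurable.
- exact: L1_norm.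
- move=> n t; rewrite mulrA normrM ler_piMl//.
  rewrite ger0_norm; last exact: mulr_ge0 (ltW (n0 n)) (pker_ge0 _ (n0 n)).
  by rewrite mulrC -ler_pdivlMr// mul1r; exact: pker_le.
- move=> t; under eq_fun do rewrite mulrA.
  suff : n.+1%:R * pker n.+1%:R t * f t @[n --> \oo] --> (1 * f t : R) by rewrite mul1r.
  by apply: cvgM; [exact: cvg_pker_scaled|exact: cvg_cst].
move=> _; under eq_fun do rewrite (RintZ _ (pker_mul_L1 (n0 _) if1)).
by [].
Qed.

Lemma cvg_Rint_qker f : L1 f ->
  n.+1%:R * \int[mu]_t (qker n.+1%:R t * f t) @[n --> \oo] --> (0 : R).
Proof.
move=> if1.
have n0 n : 0 < n.+1%:R :> R by [].
have [] := @Rint_dct R (fun n t => n.+1%:R * (qker n.+1%:R t * f t)) (fun=> 0)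
  (fun t => `|f t|).
- by move=> n; exact: L1_measurable (L1Z _ (qker_mul_L1 (n0 n) if1)).
- exact: measurable_cst.
- exact: L1_norm.
- move=> n t; rewrite mulrA normrM ler_piMl//.
  rewrite normrM (gtr0_norm (n0 n)) mulrC -ler_pdivlMr// mul1r; exact: qker_le.
- move=> t; under eq_fun do rewrite mulrA.
  suff : n.+1%:R * qker n.+1%:R t * f t @[n --> \oo] --> (0 * f t : R) by rewrite mul0r.
  by apply: cvgM; [exact: cvg_qker_scaled|exact: cvg_cst].
move=> _; under eq_fun do rewrite (RintZ _ (qker_mul_L1 (n0 _) if1)).
by rewrite (_ : \int[mu]_t (0 : R) = 0)// Rintegral_cst// mul0r.
Qed.

(** Real form of the power expansion of 1 / (t - i y).  If the two relations
    between [h] and [g] hold for t^n h and t^n g, multiplying the first by y and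
    letting y tend to infinity yields the moment of order n of [h].  Then
    t p_y = y q_y and t q_y = 1 - y p_y turn them, with the roles of the two
    relations exchanged, into the relations for t^(n+1) h and t^(n+1) g: the
    constant 1 contributes the moments of order n, which vanish. *)
Lemma conjugate_moments N g h :
  (forall n, (n < N)%N -> L1 (fun t => t ^+ n * h t)) ->
  (forall n, (n < N)%N -> L1 (fun t => t ^+ n * g t)) ->
  (forall n, (n < N)%N -> \int[mu]_t (t ^+ n * g t) = 0) ->
  (forall y, 0 < y -> \int[mu]_t (pker y t * h t) = - \int[mu]_t (qker y t * g t)) ->
  (forall y, 0 < y -> \int[mu]_t (qker y t * h t) = \int[mu]_t (pker y t * g t)) ->
  forall n, (n < N)%N -> \int[mu]_t (t ^+ n * h t) = 0.
Proof.
move=> ih ig g0 E1 E2.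
pose A n y := \int[mu]_t (pker y t * (t ^+ n * h t)).
pose A' n y := \int[mu]_t (qker y t * (t ^+ n * h t)).
pose B n y := \int[mu]_t (pker y t * (t ^+ n * g t)).
pose B' n y := \int[mu]_t (qker y t * (t ^+ n * g t)).
have moment0 n : (n < N)%N -> (forall y, 0 < y -> A n y = - B' n y) ->
    \int[mu]_t (t ^+ n * h t) = 0.
  move=> nN AB.
  have c1 := cvg_Rint_pker (ih n nN).
  have c2 : - (k.+1%:R * B' n k.+1%:R) @[k --> \oo] --> (- 0 : R).
    by apply: cvgN; exact: cvg_Rint_qker (ig n nN).
  have {}AB : (fun k : nat => k.+1%:R * A n k.+1%:R) = (fun k : nat => - (k.+1%:R * B' n k.+1%:R)).
    by apply/funext => k; rewrite AB ?ltr0Sn// mulrN.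
  rewrite -AB oppr0 in c2.
  by rewrite -(cvg_lim (@Rhausdorff R) c1); apply: cvg_lim; [exact: Rhausdorff|exact: c2].
have step_p f n y : (n < N)%N -> 0 < y ->
    \int[mu]_t (pker y t * (t ^+ n.+1 * f t)) = \int[mu]_t (y * (qker y t * (t ^+ n * f t))).
  move=> nN y0; apply: eq_Rint => t; rewrite /pker /qker [t ^+ n.+1]exprS.
  by have d0 := den_gt0 t y0; field; rewrite gt_eqF.
have step_q f n y : (n < N)%N -> 0 < y ->
    \int[mu]_t (qker y t * (t ^+ n.+1 * f t)) =
    \int[mu]_t (t ^+ n * f t - y * (pker y t * (t ^+ n * f t))).
  move=> nN y0; apply: eq_Rint => t; rewrite /pker /qker [t ^+ n.+1]exprS.
  by have d0 := den_gt0 t y0; field; rewrite gt_eqF.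
have inv n : (n < N)%N -> forall y, 0 < y -> A n y = - B' n y /\ A' n y = B n y.
  elim: n => [N0 y y0|n IH nN y y0].
    have E f k : \int[mu]_t (k t * (t ^+ 0 * f t)) = \int[mu]_t (k t * f t).
      by apply: eq_Rint => t; rewrite expr0 mul1r.
    by rewrite /A /A' /B /B' !E; split; [exact: E1|exact: E2].
  have nN' : (n < N)%N by exact: ltnW.
  have [IH1 IH2] := IH nN' y y0.
  have h0 := moment0 n nN' (fun z z0 => (IH nN' z z0).1).
  rewrite /A /A' /B /B' !step_p// !step_q//.
  have iph := pker_mul_L1 y0 (ih n nN'); have iqh := qker_mul_L1 y0 (ih n nN').
  have ipg := pker_mul_L1 y0 (ig n nN'); have iqg := qker_mul_L1 y0 (ig n nN').
  rewrite (RintB (ih n nN') (L1Z y iph)) (RintB (ig n nN') (L1Z y ipg)).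
  rewrite !(RintZ y iph, RintZ y iqh, RintZ y ipg, RintZ y iqg) h0 g0//.
  rewrite -/(A n y) -/(A' n y) -/(B n y) -/(B' n y) IH1 IH2.
  by split; ring.
by move=> n nN; apply: moment0 => // y y0; case: (inv n nN y y0).
Qed.

(** Division by t^m recovers [f] except at 0, where its value is restored
    separately. *)
Lemma measurable_monomial_mul m f :
  measurable_fun setT (fun t => t ^+ m * f t) -> measurable_fun setT f.
Proof.
move=> mf.
rewrite (_ : f = fun t => (t ^+ m)^-1 * (t ^+ m * f t) +
    ((fun=> if m is 0%N then 0 else f 0) \_ [set 0]) t).
  apply: measurable_funD.
    apply: measurable_funM => //.
    apply: (measurableT_comp (@measurable_inv R)); exact: exprn_measurable.
  by apply: measurable_fun_patch => //; exact: measurable_set1.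
apply/funext => t; rewrite /patch; case: ifPn; rewrite ?inE ?notin_setE /= => t0.
  rewrite t0; case: m {mf} => [|m]; first by rewrite expr0 invr1 !mul1r addr0.
  by rewrite expr0n /= invr0 mul0r add0r.
by rewrite addr0 mulKf// expf_neq0//; apply/eqP.
Qed.

(** For |t| >= 1 the higher power dominates; for |t| <= 1 use |f| <= 1 + f^2 and
    1 <= 2 / (t^2 + 1), which is integrable. *)
Lemma monomial_mul_L1 m n f : (n <= m)%N -> L2 f ->
  L1 (fun t => t ^+ m * f t) -> L1 (fun t => t ^+ n * f t).
Proof.
move=> nm [mf if2] im.
have ip : L1 (fun t => pker 1 t).
  by have := pker_L1 (0 : R) ltr01; apply: eq_integrable => // t _ /=; rewrite subr0.
apply: (L1_le _ (L1D (L1D (L1Z 2 ip) if2) (L1_norm im))).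
  by apply: measurable_funM => //; exact: exprn_measurable.
move=> t; rewrite !normrM !normrX.
have p0 := pker_ge0 t (@ltr01 R).
have f2 : 0 <= f t ^+ 2 by exact: sqr_ge0.
have [t1|t1] := leP `|t| 1.
  have h1 : 1 <= 2 * pker 1 t.
    rewrite /pker expr1n mulrA mulr1 ler_pdivlMr ?mul1r; last by rewrite ltr_wpDl ?sqr_ge0.
    by have : `|t| ^+ 2 <= 1; [rewrite exprn_ile1|rewrite real_normK ?num_real//; lra].
  have h2 : `|t| ^+ n * `|f t| <= `|f t| by rewrite ler_piMl// exprn_ile1.
  have h3 : 0 <= `|t| ^+ m * `|f t| by rewrite mulr_ge0// exprn_ge0.
  have : `|f t| <= 1 + f t ^+ 2.
    have := sqr_ge0 (`|f t| - 1); rewrite sqrrB1 real_normK ?num_real//.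
    by have := normr_ge0 (f t); lra.
  by move: h1 h2 h3; lra.
have h1 : `|t| ^+ n * `|f t| <= `|t| ^+ m * `|f t|.
  by rewrite ler_wpM2r// ler_eXn2l.
by move: h1; lra.
Qed.

(** Measurability of the pointwise limit is taken from the integrability of its
    top moment, which then spreads to the lower ones by [monomial_mul_L1];
    the relations needed by [conjugate_moments] are those of the L2 limit at
    the point 0, transferred along almost everywhere equality. *)
Lemma hilbertR_moments N g : (0 < N)%N -> L2 g ->
  (forall n, (n < N)%N -> L1 (fun t => t ^+ n * g t) /\ \int[mu]_t (t ^+ n * g t) = 0) ->
  L1 (fun t => t ^+ N.-1 * hilbertR g t) ->
  forall n, (n < N)%N -> L1 (fun t => t ^+ n * hilbertR g t) /\
    \int[mu]_t (t ^+ n * hilbertR g t) = 0.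
Proof.
move=> N0 l2g hg iH.
have ig1 : L1 g.
  by case: (hg 0%N N0) => i0 _; apply: eq_integrable i0 => // t _ /=; rewrite expr0 mul1r.
have [h0 [l2h E1 E2]] := hilbert_L2_limit ig1 l2g.
have aeH := hilbertR_ae_eq ig1 l2g l2h E1.
have mH : measurable_fun setT (hilbertR g).
  exact: measurable_monomial_mul (L1_measurable iH).
have l2H : L2 (hilbertR g).
  split => //; apply: (L1_ae _ (L2Z pi^-1 l2h).2); first exact: measurable_funX.
  by apply: ae_imply aeH => x ->.
have imH n : (n < N)%N -> L1 (fun t => t ^+ n * hilbertR g t).
  by move=> nN; apply: (@monomial_mul_L1 N.-1) => //; rewrite -ltnS prednK.
have pi0 : (pi : R) != 0 by rewrite gt_eqF// pi_gt0.
have replace (K : R -> R) : measurable_fun setT K -> L2 K ->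
    \int[mu]_t (K t * hilbertR g t) = pi^-1 * \int[mu]_t (K t * h0 t).
  move=> mK l2K; rewrite -(RintZ _ (L2_mul l2K l2h)).
  apply: eq_Rint_ae.
  - exact: measurable_funM.
  - by apply: measurable_funM => //; apply: measurable_funM => //; exact: l2h.1.
  - by apply: ae_imply aeH => t ->; ring.
move=> n nN; split; first exact: imH.
apply: (@conjugate_moments N g (hilbertR g)) => //.
- by move=> k kN; case: (hg k kN).
- by move=> k kN; case: (hg k kN).
- move=> y y0; have [mK _ K2 _] := tame_pker y0.
  have l2K : L2 (pker y).
    by have := K2 0; rewrite (_ : (fun x => _) = pker y)//; apply/funext => x; rewrite subr0.
  rewrite replace//.
  have := E1 y 0 y0; rewrite /convol.
  rewrite (eq_Rint (g := fun t => pker y t * h0 t)); last by move=> t; rewrite sub0r pkerN.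
  move=> ->; rewrite mulKf//.
  have iq := qker_mul_L1 y0 ig1.
  transitivity (-1 * \int[mu]_t (qker y t * g t)); last by rewrite mulN1r.
  rewrite -(RintZ _ iq); apply: eq_Rint => t.
  by rewrite sub0r qkerN mulN1r mulNr.
- move=> y y0; have [mK _ K2 _] := tame_qker y0.
  have l2K : L2 (qker y).
    by have := K2 0; rewrite (_ : (fun x => _) = qker y)//; apply/funext => x; rewrite subr0.
  rewrite replace//.
  have := E2 y 0 y0; rewrite /convol.
  have -> : \int[mu]_t (qker y (0 - t) * h0 t) = - \int[mu]_t (qker y t * h0 t).
    transitivity (-1 * \int[mu]_t (qker y t * h0 t)); last by rewrite mulN1r.
    rewrite -(RintZ _ (L2_mul l2K l2h)); apply: eq_Rint => t.
    by rewrite sub0r qkerN mulN1r mulNr.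
  move=> /oppr_inj ->; rewrite mulKf//.
  by apply: eq_Rint => t; rewrite sub0r pkerN.
Qed.

End Moments.

(** * From real to complex signals *)

Lemma Re_scale (R : realType) (c : R) (z : complex R) :
  complex.Re (c%:C%C * z) = c * complex.Re z.
Proof. by case: z => a b /=; rewrite mul0r subr0. Qed.

Lemma Im_scale (R : realType) (c : R) (z : complex R) :
  complex.Im (c%:C%C * z) = c * complex.Im z.
Proof. by case: z => a b /=; rewrite mul0r addr0. Qed.

Lemma Lfun_L2 (R : realType) (f : R -> R) :
  f \in Lfun (@lebesgue_measure R) 2%:E -> L2 f.
Proof.
move=> hf; split; last exact: Lfun2_integrable_sqr.
by move: hf; rewrite inE => /andP[]; rewrite inE.
Qed.

Lemma has_momentE (R : realType) n (f : R -> complex R) :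
  has_moment n f <-> L1 (fun t => t ^+ n * complex.Re (f t)) /\
                     L1 (fun t => t ^+ n * complex.Im (f t)).
Proof.
rewrite /has_moment /Cintegrable.
under eq_fun do rewrite Re_scale.
by under [in X in _ /\ X]eq_fun do rewrite Im_scale.
Qed.

Lemma moment_eq0 (R : realType) n (f : R -> complex R) :
  moment n f = 0 <->
  \int[@lebesgue_measure R]_t (t ^+ n * complex.Re (f t)) = 0 /\
  \int[@lebesgue_measure R]_t (t ^+ n * complex.Im (f t)) = 0.
Proof.
rewrite /moment /Cintegral.
rewrite (eq_Rint (fun t => Re_scale (t ^+ n) (f t))).
rewrite (eq_Rint (fun t => Im_scale (t ^+ n) (f t))).
by split => [[-> ->]//|[-> ->]].
Qed.

Theorem proposition2 (R : realType) (psi : R -> complex R) (N : nat)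
  (psi_wavelet : wavelet psi)
  (psi_moments : vanishing_moments N psi)
  (top_moment_exists : (0 < N)%N -> has_moment N.-1 (hilbert psi)) :
  vanishing_moments N (hilbert psi).
Proof.
move=> n nN; have N0 : (0 < N)%N by exact: leq_ltn_trans nN.
have [[re2 im2] _] := psi_wavelet.
have /has_momentE[tre tim] := top_moment_exists N0.
have hre k : (k < N)%N -> L1 (fun t => t ^+ k * complex.Re (psi t)) /\
    \int[@lebesgue_measure R]_t (t ^+ k * complex.Re (psi t)) = 0.
  by move=> /psi_moments[/has_momentE[? _] /moment_eq0[? _]].
have him k : (k < N)%N -> L1 (fun t => t ^+ k * complex.Im (psi t)) /\
    \int[@lebesgue_measure R]_t (t ^+ k * complex.Im (psi t)) = 0.
  by move=> /psi_moments[/has_momentE[_ ?] /moment_eq0[_ ?]].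
have [ire re0] := hilbertR_moments N0 (Lfun_L2 re2) hre tre nN.
have [iim im0] := hilbertR_moments N0 (Lfun_L2 im2) him tim nN.
split.
  by apply: (has_momentE n (hilbert psi)).2; exact: (conj ire iim).
by apply: (moment_eq0 n (hilbert psi)).2; exact: (conj re0 im0).
Qed.
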